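(* Let $N\ge 2$ and $d\ge 1$ be integers and let $0\le j\le N-2$. Then the number $$\frac1N\, w(\sigma_{j}({\cal O}_{h^{N-2-j}}){\cal O}_{h^{-1}}|{\cal O}_{h})_{0,d}:=\frac{d}{N}\,w(\sigma_{j}({\cal O}_{h^{N-2-j}}){\cal O}_{h^{-1}})_{0,d}+\frac{1}{N}\,w(\sigma_{j-1}({\cal O}_{h^{N-1-j}}){\cal O}_{h^{-1}})_{0,d}$$ satisfies $$\frac1N\, w(\sigma_{j}({\cal O}_{h^{N-2-j}}){\cal O}_{h^{-1}}|{\cal O}_{h})_{0,d}=\frac{1}{j!}\frac{\partial^{j}}{\partial \epsilon^{j}}\left(\frac{\prod_{r=1}^{Nd}(r+N\epsilon)}{\prod_{r=1}^{d}(r+\epsilon)^N}\right)\Bigg|_{\epsilon=0}.$$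
   Context: Let $e(x,y)=\prod_{r=0}^{N}(rx+(N-r)y)$. Let $\widetilde{Mp}_{0,2}(N,d)$ be the moduli space of degree $d$ quasimaps (polynomial maps) from $CP^1$ with two marked points to $CP^{N-1}$. It is a compact toric orbifold whose Chow ring is generated by $H_0,\dots,H_d$ with relations $H_0^N=0$, $H_i^N(2H_i-H_{i-1}-H_{i+1})=0$ ($1\le i\le d-1$), $H_d^N=0$. For integers $j\ge 0$, $a\ge 0$, $b\ge -1$ one sets $$w(\sigma_{j}({\cal O}_{h^{a}}){\cal O}_{h^{b}})_{0,d}=\int_{\widetilde{Mp}_{0,2}(N,d)}H_0^{a}(H_1-H_0)^{j}\,\frac{\prod_{l=1}^{d}e(H_{l-1},H_l)}{\prod_{l=1}^{d-1}(NH_l)}\,H_d^{b},$$ where the integrand is understood as the polynomial in $H_0,\dots,H_d$ obtained after cancellation ($e(x,y)$ is divisible by $xy$, so the factors $1/H_l$ and, for $b=-1$, $1/H_d$ cancel). Concretely, this number is given by the residue formula (which may be taken as the definition) $$w(\sigma_{j}({\cal O}_{h^{a}}){\cal O}_{h^{b}})_{0,d}=\frac{1}{(2\pi\sqrt{-1})^{d+1}}\oint_{C_0}\frac{dz_0}{z_0^N}\cdots\oint_{C_d}\frac{dz_d}{z_d^N}\; z_0^{a}(z_1-z_0)^{j}\prod_{l=1}^{d}e(z_{l-1},z_l)\prod_{l=1}^{d-1}\frac{1}{Nz_l(2z_l-z_{l-1}-z_{l+1})}\; z_d^{b},$$ where $\frac{1}{2\pi\sqrt{-1}}\oint_{C_i}dz_i$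 means taking the residue at $z_i=0$ for $i=0,d$, and the sum of the residues at $z_i=0$ and $z_i=\frac{z_{i-1}+z_{i+1}}{2}$ for $1\le i\le d-1$. Equivalently, one integrates over the torus $|z_i|=\varepsilon_i$ $(0\le i\le d)$ with $\varepsilon_i>0$ and $2\varepsilon_i>\varepsilon_{i-1}+\varepsilon_{i+1}$ for $1\le i\le d-1$. Convention: $w(\sigma_{-1}({\cal O}_{h^{a}}){\cal O}_{h^{b}})_{0,d}=0$. *)

(* Defs.v *)
From Stdlib Require Import Reals ZArith Lia Lra.
From Coquelicot Require Import Coquelicot.

Open Scope R_scope.

(* Products over [m <= r <= n], equal to 1 when [n < m]. *)
Definition Rprod (f : nat -> R) (m n : nat) : R :=
  Iter.iter_nat Rmult 1 f m n.

Definition Cprod (f : nat -> C) (m n : nat) : C :=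
  Iter.iter_nat Cmult (RtoC 1) f m n.

Definition Czpow (z : C) (k : Z) : C :=
  match k with
  | Zneg p => (/ (z ^ Pos.to_nat p))%C
  | _ => (z ^ Z.to_nat k)%C
  end.

Definition circle (r t : R) : C := (r * cos t, r * sin t).

(* [1 / (2 pi i)] times the integral of [g] over the positively oriented circle
   [|w| = r], parametrized by [w = r e^{it}], [dw = i w dt].  The integral is
   taken in C seen as a normed module over the reals. *)
Definition contour_int (r : R) (g : C -> C) : C :=
  (/ (RtoC (2 * PI) * Ci)
   * RInt (V := C_R_CompleteNormedModule)
       (fun t : R => g (circle r t) * (Ci * circle r t))%C 0%R (2 * PI)%R)%C.

Definition upd (z : nat -> C) (i : nat) (w : C) : nat -> C :=
  fun k => if Nat.eqb k i then w else z k.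

(* Iterated normalized contour integral over [z_i, ..., z_{i+n-1}], with [z_i]
   outermost and [z_{i+n-1}] innermost; the other coordinates are those of [z]. *)
Fixpoint torus_int_from (eps : nat -> R) (i n : nat)
    (F : (nat -> C) -> C) (z : nat -> C) : C :=
  match n with
  | O => F z
  | S n' => contour_int (eps i)
              (fun w => torus_int_from eps (S i) n' F (upd z i w))
  end.

Definition torus_int (eps : nat -> R) (d : nat) (F : (nat -> C) -> C) : C :=
  torus_int_from eps 0 (S d) F (fun _ => RtoC 0).

(* The torus [|z_i| = eps i], [0 <= i <= d], then avoids every hyperplane
   [z_i = 0] and [2 z_i = z_{i-1} + z_{i+1}], and both points [0] and
   [(z_{i-1} + z_{i+1}) / 2] lie inside the circle of [z_i]. *)
Definition admissible (d : nat) (eps : nat -> R) : Prop :=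
  (forall i : nat, (i <= d)%nat -> 0 < eps i) /\
  (forall i : nat, (1 <= i <= d - 1)%nat ->
     eps (i - 1)%nat + eps (i + 1)%nat < 2 * eps i).

Lemma admissible_exists (d : nat) : exists eps : nat -> R, admissible d eps.
Proof.
exists (fun i => 1 + INR i * (INR d - INR i)); split; intros i Hi.
- assert (INR i <= INR d) by (apply le_INR; lia).
  assert (0 <= INR i) by apply pos_INR.
  nra.
- rewrite minus_INR, plus_INR by lia; simpl (INR 1); nra.
Qed.

Definition e_poly (N : nat) (x y : C) : C :=
  Cprod (fun r => RtoC (INR r) * x + RtoC (INR (N - r)) * y)%C 0 N.

Definition w_integrand (N d j a : nat) (b : Z) (z : nat -> C) : C :=
  (Cprod (fun i => / (z i ^ N)) 0 d
   * (z 0%nat ^ a * (z 1%nat - z 0%nat) ^ j)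
   * Cprod (fun l => e_poly N (z (l - 1)%nat) (z l)) 1 d
   * Cprod (fun l =>
       / (RtoC (INR N) * z l
          * (RtoC 2 * z l - z (l - 1)%nat - z (l + 1)%nat))) 1 (d - 1)
   * Czpow (z d) b)%C.

(* [w (sigma_j(O_{h^a}) O_{h^b})_{0,d}], computed on the torus of radii [eps].
   The sums of residues at [z_i = 0] and [z_i = (z_{i-1} + z_{i+1}) / 2] are
   expressed by this integral, because the second point depends on variables
   over which one also takes residues.  The value is meant for [admissible d eps]
   and [b >= -1]; it is [0] for negative [j], as is the convention for [j = -1]. *)
Definition w_num (N d : nat) (eps : nat -> R) (j : Z) (a : nat) (b : Z) : C :=
  match j with
  | Zneg _ => RtoC 0
  | _ => torus_int eps d (w_integrand N d (Z.to_nat j) a b)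
  end.

(* [(1/N) w (sigma_j(O_{h^{N-2-j}}) O_{h^{-1}} | O_h)_{0,d}], for [j <= N - 2]. *)
Definition w_num_h_over_N (N d : nat) (eps : nat -> R) (j : nat) : C :=
  (RtoC (INR d / INR N) * w_num N d eps (Z.of_nat j) (N - 2 - j) (-1)
   + RtoC (1 / INR N)
     * w_num N d eps (Z.of_nat j - 1) (N - 1 - j) (-1))%C.

(* Main.v *)
(** The integral does not depend on the radius of [z_0], which may be taken tiny.  The integrand is then, up to a
power of [N], a product of [d - 1] factors [1 / (2 z_l - z_{l-1} - z_{l+1})] and a Laurent
polynomial whose part in [z_0, ..., z_k] has joint degree [-1].  For [k = 1, ..., d - 1] in turn,
the integral over [(z_0, z_k)] equals the residue at the point where [z_0, ..., z_{k+1}] are in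
arithmetic progression: shrinking both circles together makes the integral vanish, by homogeneity,
and crosses that pole only.  Once all [z_l = (epsilon + l) v] are in arithmetic progression,
[prod_l e(z_{l-1}, z_l)] becomes [prod_{r <= N d} (r + N epsilon)] up to elementary factors, and
the integral over [z_0, z_d] extracts the coefficient of [epsilon ^ j] of
[phi = f / (d + epsilon)], where [f] is the function on the right-hand side.  Hence
[w(sigma_j ...) = N phi_j], and [d phi_j + phi_{j-1} = f_j].

Instead of moving contours, functions on the torus are expanded as uniform limits of Laurent
polynomials, for which integration is the extraction of the coefficient of [prod_i 1 / z_i]; a
bound on the weights of the monomials that occur then suffices to make an integral vanish. *)

Require Import Defs.
From Stdlib Require Import Reals ZArith Lia Lra Psatz.
From Stdlib Require Import Classical FunctionalExtensionality List ssreflect.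
From Coquelicot Require Import Coquelicot.
Open Scope R_scope.

(** * Contour integrals *)

(** Why [z_0] must be small: moving [z_1, ..., z_{k-1}] into progression between [z_0] and [z_k]
    creates the new poles [i z_k + (k - i) z_0 = 0]. They are harmless once [(k - 1) |z_0|] is below
    [|z_k|], and this must hold also after [z_k] has been moved to the residue point, where it is
    smaller. Why joint degree [-1] is the threshold: for the monomial [z_0^(-1) z_k^(-1)], of degree
    [-2], the residue at that point keeps a pole in [z_0], and the comparison of the two integrals
    fails. The degree [-1] is the effect of [a = N - 2 - j]: the exponent of [z_0] becomes
    [-(j + 1)], against [(z_1 - z_0)^j] and factors of degree 0. Uniform limits of Laurent
    polynomials also settle the measure-theoretic side: the class is preserved by integration in one
    variable, so every inner integral is again integrable. *)

Definition contour_integrable (r : R) (g : C -> C) : Prop :=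
  ex_RInt (V := C_R_NormedModule)
    (fun t : R => g (circle r t) * (Ci * circle r t))%C 0%R (2 * PI)%R.

Lemma norm_C_R (x : C_R_NormedModule) : norm x = Cmod x.
Proof.
rewrite /norm /= /prod_norm /norm /= /Cmod /abs /=; f_equal.
by rewrite !Rmult_1_r -!Rabs_mult !(Rabs_pos_eq (_ * _)) //; nra.
Qed.

Lemma Cmod_circle (r t : R) : 0 < r -> Cmod (circle r t) = r.
Proof.
move=> Hr; rewrite /Cmod /circle /=.
replace (_ + _) with (r * r).
  by rewrite sqrt_square //; lra.
have := sin2_cos2 t; rewrite /Rsqr; nra.
Qed.

(** The integral is taken in a real module, where a complex constant is not a scalar; hence the
    passage to real and imaginary parts. *)
Lemma is_RInt_Cmult (c : C) (f : R -> C) (a b : R) (l : C) :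
  is_RInt (V := C_R_NormedModule) f a b l ->
  is_RInt (V := C_R_NormedModule) (fun t => c * f t)%C a b (c * l)%C.
Proof.
move=> H.
have H1 := is_RInt_fct_extend_fst (U := R_NormedModule) (V := R_NormedModule) f a b l H.
have H2 := is_RInt_fct_extend_snd (U := R_NormedModule) (V := R_NormedModule) f a b l H.
apply: (is_RInt_fct_extend_pair (U := R_NormedModule) (V := R_NormedModule)) => /=.
- apply: (is_RInt_minus (V := R_NormedModule)); exact: (is_RInt_scal (V := R_NormedModule)).
- apply: (is_RInt_plus (V := R_NormedModule)); exact: (is_RInt_scal (V := R_NormedModule)).
Qed.

Lemma contour_int_correct (r : R) (g : C -> C) (l : C) :
  is_RInt (V := C_R_NormedModule)
    (fun t : R => g (circle r t) * (Ci * circle r t))%C 0%R (2 * PI)%R l ->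
  contour_int r g = (/ (RtoC (2 * PI) * Ci) * l)%C.
Proof.
move=> H; rewrite /contour_int; congr (_ * _)%C.
exact: (is_RInt_unique (V := C_R_CompleteNormedModule)).
Qed.

Lemma contour_int_ext (r : R) (g h : C -> C) :
  (forall t, g (circle r t) = h (circle r t)) ->
  contour_int r g = contour_int r h.
Proof.
move=> H; rewrite /contour_int; congr (_ * RInt (V := C_R_CompleteNormedModule) _ _ _)%C.
by apply: functional_extensionality => t; rewrite H.
Qed.

Lemma contour_integrable_ext (r : R) (g h : C -> C) :
  (forall t, g (circle r t) = h (circle r t)) ->
  contour_integrable r g -> contour_integrable r h.
Proof. by move=> H; apply: ex_RInt_ext => t _; rewrite H. Qed.

Lemma contour_lincomb (r : R) (c : C) (g h : C -> C) :
  contour_integrable r g -> contour_integrable r h ->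
  contour_integrable r (fun w => c * g w + h w)%C /\
  contour_int r (fun w => c * g w + h w)%C
  = (c * contour_int r g + contour_int r h)%C.
Proof.
move=> [lg Hg] [lh Hh].
have H : is_RInt (V := C_R_NormedModule)
  (fun t : R => (c * g (circle r t) + h (circle r t)) * (Ci * circle r t))%C
  0%R (2 * PI)%R (c * lg + lh)%C.
  apply: is_RInt_ext; last first.
    apply: (is_RInt_plus (V := C_R_NormedModule)); last exact: Hh.
    exact: is_RInt_Cmult c _ _ _ _ Hg.
  move=> t _ /=; rewrite /plus /=. 
  change prod_plus with Cplus. 
  change (@prod_plus _ _ ?x ?y) with (Cplus x y).
  ring.
split; first by exists (c * lg + lh)%C.
rewrite (contour_int_correct _ _ _ H) (contour_int_correct _ _ _ Hg)
  (contour_int_correct _ _ _ Hh); ring.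
Qed.

Lemma contour_scal (r : R) (c : C) (g : C -> C) : contour_integrable r g ->
  contour_integrable r (fun w => c * g w)%C /\
  contour_int r (fun w => c * g w)%C = (c * contour_int r g)%C.
Proof.
(* Writing [c g = (c - 1) g + g] avoids a separate integrability proof for the zero function;
   integrals over the torus are scaled in the same way below. *)
move=> Hg; have [H1 H2] := contour_lincomb r (c - 1)%C g g Hg Hg.
have E : forall t, ((c - 1) * g (circle r t) + g (circle r t))%C = (c * g (circle r t))%C.
  by move=> t; ring.
split; first exact: contour_integrable_ext E H1.
transitivity (contour_int r (fun w => (c - 1) * g w + g w)%C).
  by apply: contour_int_ext => t; rewrite E.
rewrite H2; ring.
Qed.

Lemma two_pi_i_neq_0 : (RtoC (2 * PI) * Ci)%C <> 0.
Proof.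
have HP := PI_RGT_0.
move=> H; have := Cmod_mult (RtoC (2 * PI)) Ci.
rewrite H Cmod_0 Cmod_R Cmod_Ci Rabs_pos_eq; lra.
Qed.

Lemma contour_int_bound (r M : R) (g : C -> C) : 0 < r ->
  contour_integrable r g -> (forall t, Cmod (g (circle r t)) <= M) ->
  Cmod (contour_int r g) <= r * M.
Proof.
move=> Hr [l Hl] HM.
rewrite (contour_int_correct _ _ _ Hl).
have HP := PI_RGT_0.
have H : norm l <= (2 * PI - 0) * (M * r).
  apply: (norm_RInt_le_const (V := C_R_NormedModule)) Hl; first lra.
  move=> t _; rewrite norm_C_R !Cmod_mult Cmod_Ci Cmod_circle // Rmult_1_l.
  apply: Rmult_le_compat_r; [lra | exact: HM].
rewrite norm_C_R in H.
rewrite Cmod_mult Cmod_inv; last exact: two_pi_i_neq_0.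
rewrite Cmod_mult Cmod_R Cmod_Ci Rabs_pos_eq; last lra.
apply: (Rmult_le_reg_l (2 * PI)); first lra.
rewrite Rmult_1_r -Rmult_assoc Rinv_r; lra.
Qed.

Lemma contour_integrable_lim (r : R) (g : C -> C) : 0 < r ->
  (forall delta, 0 < delta -> exists h, contour_integrable r h /\
     forall t, Cmod (g (circle r t) - h (circle r t))%C <= delta) ->
  contour_integrable r g.
Proof.
move=> Hr Hlim.
set phi := fun (h : C -> C) (t : R) => (h (circle r t) * (Ci * circle r t))%C.
pose U := {h : C -> C | contour_integrable r h}.
(* The filter of uniform convergence to [g] among integrable functions; the hypothesis makes it
   proper. *)
pose F := fun P : U -> Prop => exists delta, 0 < delta /\
   forall h : U, (forall t, Cmod (g (circle r t) - proj1_sig h (circle r t))%C <= delta) -> P h.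
have FF : ProperFilter F.
  split.
  - move=> P [delta [Hd HP]]; have [h [Hh Hb]] := Hlim delta Hd.
    by exists (exist _ h Hh); apply: HP.
  - split.
    + by exists 1; split; [lra|].
    + move=> P Q [a [Ha HP]] [b [Hb HQ]]; exists (Rmin a b); split.
        exact: Rmin_pos.
      move=> h Hh; split.
      * apply: HP => t; exact: Rle_trans (Hh t) (Rmin_l _ _).
      * apply: HQ => t; exact: Rle_trans (Hh t) (Rmin_r _ _).
    + by move=> P Q HPQ [a [Ha HP]]; exists a; split=> // h Hh; apply: HPQ; apply: HP.
suff Hu : filterlim (fun h : U => phi (proj1_sig h)) F
    (locally (T := fct_UniformSpace R C_R_CompleteNormedModule) (phi g)).
  have [l [_ Hl]] := filterlim_RInt (V := C_R_CompleteNormedModule)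
    (fun h : U => phi (proj1_sig h)) 0 (2 * PI) F FF (phi g)
    (fun h : U => RInt (V := C_R_CompleteNormedModule) (phi (proj1_sig h)) 0 (2 * PI))
    (fun h => RInt_correct (V := C_R_CompleteNormedModule) _ _ _ (proj2_sig h)) Hu.
  by exists l.
apply/filterlim_locally => eps.
(* The [r] absorbs the modulus of [dw], the 2 makes the inequality strict. *)
exists (eps / (2 * r)); split.
  apply: Rdiv_lt_0_compat; [exact: cond_pos | lra].
move=> h Hh t.
apply: (norm_compat1 (V := C_R_NormedModule)).
rewrite norm_C_R.
change (Cmod (phi (proj1_sig h) t - phi g t)%C < eps).
replace (phi (proj1_sig h) t - phi g t)%C with
  (- (g (circle r t) - proj1_sig h (circle r t)) * (Ci * circle r t))%C
  by (rewrite /phi; ring).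
rewrite !Cmod_mult Cmod_opp Cmod_Ci Cmod_circle // Rmult_1_l.
apply: (Rle_lt_trans _ (eps / (2 * r) * r)).
  apply: Rmult_le_compat_r; [lra | exact: Hh].
have := cond_pos eps => He.
replace (eps / (2 * r) * r) with (eps / 2); [lra | field; lra].
Qed.

Definition Cexpi (x : R) : C := (cos x, sin x).

Lemma Cexpi_plus (x y : R) : Cexpi (x + y) = (Cexpi x * Cexpi y)%C.
Proof. by rewrite /Cexpi /Cmult /= cos_plus sin_plus; f_equal; ring. Qed.

Lemma Cexpi_0 : Cexpi 0 = 1.
Proof. by rewrite /Cexpi cos_0 sin_0. Qed.

Lemma Cexpi_pow (x : R) (n : nat) : (Cexpi x ^ n)%C = Cexpi (INR n * x).
Proof.
elim: n => [|n IH]; first by rewrite /= Rmult_0_l Cexpi_0.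
by rewrite Cpow_S IH -Cexpi_plus S_INR; f_equal; ring.
Qed.

Lemma circle_Cexpi (r t : R) : circle r t = (RtoC r * Cexpi t)%C.
Proof. by rewrite /circle /Cexpi /Cmult /RtoC /=; f_equal; ring. Qed.

Lemma Cexpi_neq_0 (x : R) : Cexpi x <> 0.
Proof.
move=> H; have := Cexpi_plus x (- x); rewrite H Rplus_opp_r Cexpi_0 Cmult_0_l.
by move=> /RtoC_inj; lra.
Qed.

Lemma Cexpi_inv (x : R) : (/ Cexpi x)%C = Cexpi (- x).
Proof.
have H := Cexpi_neq_0 x.
have E : (Cexpi x * Cexpi (- x))%C = 1 by rewrite -Cexpi_plus Rplus_opp_r Cexpi_0.
rewrite -[RHS]Cmult_1_l -[X in (X * _)%C](Cinv_l (Cexpi x)) // -Cmult_assoc E; ring.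
Qed.

Lemma Czpow_circle (r t : R) (n : Z) : 0 < r ->
  Czpow (circle r t) n = (RtoC (powerRZ r n) * Cexpi (IZR n * t))%C.
Proof.
move=> Hr; have HrC : RtoC r <> 0 by move/RtoC_inj; lra.
rewrite circle_Cexpi; case: n => [|p|p] /=.
- by rewrite Rmult_0_l Cexpi_0 Cmult_1_r.
- rewrite Cpow_mult_l Cexpi_pow -RtoC_pow; do 2 f_equal.
  by rewrite INR_IPR -/(IZR (Z.pos p)).
- rewrite Cpow_mult_l Cexpi_pow -RtoC_pow.
  have H1 : RtoC (r ^ Pos.to_nat p) <> 0.
    by move/RtoC_inj; apply: pow_nonzero; lra.
  have H2 := Cexpi_neq_0 (INR (Pos.to_nat p) * t).
  have -> : forall a b : C, a <> 0 -> b <> 0 -> (/ (a * b) = / a * / b)%C.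
    by move=> a b Ha Hb; field.
  all: try done.
  rewrite -RtoC_inv; last by apply: pow_nonzero; lra.
  rewrite Cexpi_inv; do 2 f_equal.
  by rewrite INR_IPR /IZR; ring.
Qed.

Lemma is_RInt_Cexpi (m : Z) :
  is_RInt (V := C_R_NormedModule) (fun t => Cexpi (IZR m * t)) 0 (2 * PI)
    (if (m =? 0)%Z then RtoC (2 * PI) else RtoC 0).
Proof.
case: Z.eqb_spec => [->|Hm].
  apply: is_RInt_ext.
    by move=> t _; rewrite Rmult_0_l Cexpi_0.
  have := is_RInt_const (V := C_R_NormedModule) 0 (2 * PI) (RtoC 1).
  congr is_RInt; rewrite /scal /= /prod_scal /scal /= /mult /= /RtoC.
  by f_equal; ring.
have Hm' : IZR m <> 0 by apply: not_0_IZR.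
have Hs : sin (IZR m * (2 * PI)) = 0.
  by replace (IZR m * (2 * PI)) with (IZR (2 * m) * PI);
    [apply: sin_eq_0_1; exists (2 * m)%Z | rewrite mult_IZR; ring].
have Hc : cos (IZR m * (2 * PI)) = 1.
  replace (IZR m * (2 * PI)) with (2 * (IZR m * PI)) by ring.
  rewrite cos_2a_sin.
  have -> : sin (IZR m * PI) = 0 by apply: sin_eq_0_1; exists m.
  ring.
apply: (is_RInt_fct_extend_pair (U := R_NormedModule) (V := R_NormedModule)) => /=.
- have H := is_RInt_derive (V := R_CompleteNormedModule)
     (fun t => sin (IZR m * t) / IZR m) (fun t => cos (IZR m * t)) 0 (2 * PI).
  have := H _ _; rewrite Hs Rmult_0_r sin_0.
  rewrite /minus /plus /opp /=.
  replace (0 / IZR m + - (0 / IZR m)) with 0 by (field; lra).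
  apply.
  + move=> t _; auto_derive => //; field; lra.
  + move=> t _; apply: (ex_derive_continuous (V := R_NormedModule)); auto_derive => //.
- have H := is_RInt_derive (V := R_CompleteNormedModule)
     (fun t => - cos (IZR m * t) / IZR m) (fun t => sin (IZR m * t)) 0 (2 * PI).
  have := H _ _; rewrite Hc Rmult_0_r cos_0.
  rewrite /minus /plus /opp /=.
  replace (- (1) / IZR m + - (- (1) / IZR m)) with 0 by (field; lra).
  apply.
  + move=> t _; auto_derive => //; field; lra.
  + move=> t _; apply: (ex_derive_continuous (V := R_NormedModule)); auto_derive => //.
Qed.

Lemma contour_Czpow (r : R) (n : Z) : 0 < r ->
  contour_integrable r (fun w => Czpow w n) /\
  contour_int r (fun w => Czpow w n) = if (n =? -1)%Z then RtoC 1 else RtoC 0.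
Proof.
move=> Hr.
have H : is_RInt (V := C_R_NormedModule)
    (fun t : R => Czpow (circle r t) n * (Ci * circle r t))%C 0 (2 * PI)
    (RtoC (powerRZ r n) * Ci * RtoC r *
       if (n + 1 =? 0)%Z then RtoC (2 * PI) else RtoC 0)%C.
  apply: is_RInt_ext; last exact: is_RInt_Cmult _ _ _ _ _ (is_RInt_Cexpi (n + 1)).
  move=> t _ /=; rewrite Czpow_circle // circle_Cexpi plus_IZR.
  by rewrite Rmult_plus_distr_r Rmult_1_l Cexpi_plus; ring.
split; first by eexists; exact: H.
rewrite (contour_int_correct _ _ _ H).
have HrC : RtoC r <> 0 by move/RtoC_inj; lra.
have HP : RtoC (2 * PI) <> 0 by move/RtoC_inj; have := PI_RGT_0; lra.
have HI : Ci <> 0 by rewrite Cmod_gt_0 Cmod_Ci; lra.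
case: (Z.eqb_spec n (-1)) => [->|Hn] /=.
  rewrite Rmult_1_r RtoC_inv; last lra. 
  by field.
have -> : (n + 1 =? 0)%Z = false by apply/Z.eqb_neq; lia.
ring.
Qed.

Lemma Czpow_add (z : C) (a b : Z) : z <> 0 ->
  Czpow z (a + b) = (Czpow z a * Czpow z b)%C.
Proof.
move=> Hz.
have key : forall n m : nat, Czpow z (Z.of_nat n - Z.of_nat m) = (z ^ n / z ^ m)%C.
  move=> n m.
  have Hn := Cpow_nz z n Hz. have Hm := Cpow_nz z m Hz.
  case E : (Z.of_nat n - Z.of_nat m)%Z => [|p|p] /=.
  - have -> : n = m by lia. 
    by field.
  - have -> : n = (Pos.to_nat p + m)%nat by lia.
    rewrite Cpow_add_r; by field.
  - have -> : m = (Pos.to_nat p + n)%nat by lia.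
    rewrite Cpow_add_r; have Hp := Cpow_nz z (Pos.to_nat p) Hz; by field.
have rep : forall a : Z, exists n m, a = (Z.of_nat n - Z.of_nat m)%Z.
  by move=> c; exists (Z.to_nat c), (Z.to_nat (- c)); lia.
case: (rep a) => [n [m ->]]; case: (rep b) => [n' [m' ->]].
replace (Z.of_nat n - Z.of_nat m + (Z.of_nat n' - Z.of_nat m'))%Z
  with (Z.of_nat (n + n') - Z.of_nat (m + m'))%Z by lia.
rewrite !key !Cpow_add_r.
have Hm := Cpow_nz z m Hz. have Hm' := Cpow_nz z m' Hz. 
by field.
Qed.

(** * Iterated integrals of limits of Laurent polynomials *)

Lemma Cprod_nil (f : nat -> C) (m n : nat) : (n < m)%nat -> Cprod f m n = 1.
Proof. by move=> H; rewrite /Cprod /Iter.iter_nat; replace (S n - m)%nat with 0%nat by lia. Qed.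

Lemma Cprod_1 (f : nat -> C) (n : nat) : Cprod f n n = f n.
Proof. by apply: Iter.iter_nat_point; exact: Cmult_1_r. Qed.

Lemma Cprod_recr (f : nat -> C) (m n : nat) : (m <= S n)%nat ->
  Cprod f m (S n) = (Cprod f m n * f (S n))%C.
Proof.
move=> H; rewrite /Cprod (Iter.iter_nat_Chasles _ _ Cmult_1_l Cmult_assoc f m n) //; last lia.
by congr (_ * _)%C; exact: Cprod_1.
Qed.

Lemma Cprod_recl (f : nat -> C) (m n : nat) : (m <= n)%nat ->
  Cprod f m n = (f m * Cprod f (S m) n)%C.
Proof.
move=> H; rewrite /Cprod (Iter.iter_nat_Chasles _ _ Cmult_1_l Cmult_assoc f m m) //; last lia.
by congr (_ * _)%C; exact: Cprod_1.
Qed.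

Lemma Cprod_ext (f g : nat -> C) (m n : nat) :
  (forall k, (m <= k <= n)%nat -> f k = g k) -> Cprod f m n = Cprod g m n.
Proof. exact: Iter.iter_nat_ext_loc. Qed.

Lemma Cprod_mult (f g : nat -> C) (m n : nat) :
  Cprod (fun k => f k * g k)%C m n = (Cprod f m n * Cprod g m n)%C.
Proof.
case: (le_lt_dec m n) => [H|H]; last by rewrite !Cprod_nil // Cmult_1_l.
have [k ->] : exists k, n = (m + k)%nat by exists (n - m)%nat; lia.
elim: k {H} => [|k IH].
  by rewrite Nat.add_0_r !Cprod_1.
rewrite Nat.add_succ_r !Cprod_recr ?IH; try lia; ring.
Qed.

Lemma Cprod_neq_0 (f : nat -> C) (m n : nat) :
  (forall k, (m <= k <= n)%nat -> f k <> 0) -> Cprod f m n <> 0.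
Proof.
case: (le_lt_dec m n) => [H|H]; last by rewrite Cprod_nil // => _ /RtoC_inj; lra.
have [k ->] : exists k, n = (m + k)%nat by exists (n - m)%nat; lia.
elim: k {H} => [|k IH] Hf.
  rewrite Nat.add_0_r Cprod_1; apply: Hf; lia.
rewrite Nat.add_succ_r Cprod_recr; last lia.
apply: Cmult_neq_0; [apply: IH => i Hi|]; apply: Hf; lia.
Qed.

Lemma Cprod_eq_1 (f : nat -> C) (n : nat) :
  (forall k, (k <= n)%nat -> f k = 1) -> Cprod f 0 n = 1.
Proof.
elim: n => [|n IH] Hf; first by rewrite Cprod_1 Hf.
by rewrite Cprod_recr ?IH ?Hf ?Cmult_1_l //; [move=> k Hk; apply: Hf|]; lia.
Qed.

Definition mon (d : nat) (e : nat -> Z) (z : nat -> C) : C :=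
  Cprod (fun i => Czpow (z i) (e i)) 0 d.

(** A sum of terms with no collection of equal monomials: [D] is then a condition on each term, and
    every property is an induction on the terms. *)
Inductive laurent (d : nat) (D : (nat -> Z) -> Prop) : ((nat -> C) -> C) -> Prop :=
| laurent_0 : laurent d D (fun _ => RtoC 0)
| laurent_add c e P : D e -> laurent d D P ->
    laurent d D (fun z => c * mon d e z + P z)%C.

Definition approx (d : nat) (D : (nat -> Z) -> Prop) (X : (nat -> C) -> Prop)
    (F : (nat -> C) -> C) : Prop :=
  forall delta, 0 < delta -> exists P, laurent d D P /\
    forall z, X z -> Cmod (F z - P z)%C <= delta.

Lemma approx_sub (d : nat) (D D' : (nat -> Z) -> Prop) (X X' : (nat -> C) -> Prop) F :
  (forall e, D e -> D' e) -> (forall z, X' z -> X z) -> approx d D X F -> approx d D' X' F.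
Proof.
move=> HD HX HF delta Hd; case: (HF delta Hd) => P [HP HFP].
exists P; split; last by move=> z /HX; exact: HFP.
elim: HP => [|c e Q He _ IH]; constructor=> //; exact: HD.
Qed.

Lemma approx_ext (d : nat) (D : (nat -> Z) -> Prop) (X : (nat -> C) -> Prop) F G :
  (forall z, X z -> F z = G z) -> approx d D X F -> approx d D X G.
Proof.
move=> HFG HF delta Hd; case: (HF delta Hd) => P [HP HFP].
by exists P; split=> // z Hz; rewrite -HFG //; apply: HFP.
Qed.

Lemma mon_upd (d i : nat) (e : nat -> Z) (z : nat -> C) (w : C) : (i <= d)%nat ->
  mon d e (upd z i w) =
  (Czpow w (e i) * mon d (fun k => if (k =? i)%nat then 0%Z else e k) z)%C.
Proof.
rewrite /mon /upd; elim: d => [|d IH] Hi.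
  have -> : i = 0%nat by lia.
  by rewrite !Cprod_1 /= Cmult_1_r.
rewrite !Cprod_recr; [|lia|lia].
case: (Nat.eqb_spec (S d) i) => [E|E].
  rewrite -E /= Cmult_1_r Cmult_comm; congr (_ * _)%C.
  by apply: Cprod_ext => k Hk; have -> : (k =? S d)%nat = false by apply/Nat.eqb_neq; lia.
rewrite IH; last lia. by rewrite Cmult_assoc.
Qed.

Section Torus.

Variables (d : nat) (eps : nat -> R).
Hypothesis eps_pos : forall i, (i <= d)%nat -> 0 < eps i.

(* The coordinates from [i] on are left free: [torus_int_from] integrates them out. *)
Definition torus_upto (i : nat) (z : nat -> C) : Prop :=
  forall k, (k < i)%nat -> Cmod (z k) = eps k.

(** Once [z_i, ..., z_d] are integrated out, no monomial may involve them. *)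
Definition supp_upto (i : nat) (e : nat -> Z) : Prop :=
  forall k, (i <= k <= d)%nat -> e k = 0%Z.

Lemma torus_upto_upd (i : nat) (z : nat -> C) (t : R) : (i <= d)%nat ->
  torus_upto i z -> torus_upto (S i) (upd z i (circle (eps i) t)).
Proof.
move=> Hi Hz k Hk; rewrite /upd; case: Nat.eqb_spec => [->|E].
  by rewrite Cmod_circle //; apply: eps_pos.
apply: Hz; lia.
Qed.

(** Term by term: a monomial survives only if [e i = -1], and it then loses its power of [z_i]. *)
Lemma contour_laurent (i : nat) (P : (nat -> C) -> C) : (i <= d)%nat ->
  laurent d (supp_upto (S i)) P ->
  exists P', laurent d (supp_upto i) P' /\
    forall z, contour_integrable (eps i) (fun w => P (upd z i w)) /\
      contour_int (eps i) (fun w => P (upd z i w)) = P' z.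
Proof.
move=> Hi; have Hr := eps_pos i Hi; elim=> [|c e Q He HQ [Q' [HQ' H]]].
  exists (fun _ => RtoC 0); split; first by constructor.
  move=> z; have [H1 _] := contour_Czpow (eps i) 0 Hr.
  have [H2 H3] := contour_scal (eps i) 0%C _ H1.
  have E : forall t, (0 * Czpow (circle (eps i) t) 0)%C = 0 by move=> t; ring.
  split; first exact: contour_integrable_ext E H2.
  transitivity (contour_int (eps i) (fun w => 0 * Czpow w 0)%C).
    by apply: contour_int_ext => t; rewrite E.
  rewrite H3; ring.
set e' := fun k => if (k =? i)%nat then 0%Z else e k.
have [H1 H2] := contour_Czpow (eps i) (e i) Hr.
exists (fun z => (c * if (e i =? -1)%Z then RtoC 1 else RtoC 0) * mon d e' z + Q' z)%C; split.
  constructor=> // k Hk; rewrite /e'; case: Nat.eqb_spec => // E; apply: He; lia.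
move=> z; have [H3 H4] := H z.
have [H5 H6] := contour_lincomb (eps i) (c * mon d e' z)%C _ _ H1 H3.
split.
  apply: contour_integrable_ext H5 => t /=; rewrite mon_upd // -/e'; ring.
transitivity (contour_int (eps i)
  (fun w => c * mon d e' z * Czpow w (e i) + Q (upd z i w))%C).
  apply: contour_int_ext => t /=; rewrite mon_upd // -/e'; ring.
rewrite H6 H2 H4; ring.
Qed.

(** The inductive step behind all iterated integrals: integration is continuous for the uniform
    norm, so a limit of Laurent polynomials is integrable and its integral is again such a limit in
    the remaining variables. *)
Lemma contour_approx (i : nat) (K : (nat -> C) -> C) : (i <= d)%nat ->
  approx d (supp_upto (S i)) (torus_upto (S i)) K ->
  (forall z, torus_upto i z -> contour_integrable (eps i) (fun w => K (upd z i w))) /\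
  approx d (supp_upto i) (torus_upto i)
    (fun z => contour_int (eps i) (fun w => K (upd z i w))).
Proof.
move=> Hi HK; have Hr := eps_pos i Hi.
have Hint : forall z, torus_upto i z -> contour_integrable (eps i) (fun w => K (upd z i w)).
  move=> z Hz; apply: contour_integrable_lim => // delta Hd.
  have [P [HP HKP]] := HK delta Hd.
  have [P' [_ H]] := contour_laurent i P Hi HP.
  exists (fun w => P (upd z i w)); split; first by have [] := H z.
  by move=> t; apply: HKP; apply: torus_upto_upd.
split=> // delta Hd.
(* Compensates the factor [eps i] of [contour_int_bound]. *)
have Hd' : 0 < delta / eps i by apply: Rdiv_lt_0_compat.
have [P [HP HKP]] := HK _ Hd'.
have [P' [HP' H]] := contour_laurent i P Hi HP.
exists P'; split=> // z Hz.
have [H1 H2] := H z.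
have [H3 H4] := contour_lincomb (eps i) (RtoC (-1)) _ _ H1 (Hint z Hz).
replace (contour_int (eps i) (fun w => K (upd z i w)) - P' z)%C with
  (RtoC (-1) * contour_int (eps i) (fun w => P (upd z i w))
    + contour_int (eps i) (fun w => K (upd z i w)))%C; last first.
  by rewrite H2; ring.
rewrite -H4.
replace delta with (eps i * (delta / eps i)) by (field; lra).
apply: contour_int_bound => // t.
replace (RtoC (-1) * _ + _)%C with
  (K (upd z i (circle (eps i) t)) - P (upd z i (circle (eps i) t)))%C by ring.
by apply: HKP; apply: torus_upto_upd.
Qed.

Lemma torus_int_from_approx (n i : nat) (F : (nat -> C) -> C) : (i + n = S d)%nat ->
  approx d (supp_upto (S d)) (torus_upto (S d)) F ->
  approx d (supp_upto i) (torus_upto i) (torus_int_from eps i n F).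
Proof.
elim: n i => [|n IH] i Hi HF /=.
  by have -> : i = S d by lia.
apply: (proj2 (contour_approx i _ ltac:(lia) _)).
by apply: IH => //; lia.
Qed.

Lemma torus_int_from_ext (n i : nat) (F G : (nat -> C) -> C) z : (i + n = S d)%nat ->
  (forall z, torus_upto (S d) z -> F z = G z) -> torus_upto i z ->
  torus_int_from eps i n F z = torus_int_from eps i n G z.
Proof.
elim: n i z => [|n IH] i z Hi HFG Hz /=.
  by apply: HFG; have <- : i = S d by lia.
by apply: contour_int_ext => t; apply: IH => //; [lia | apply: torus_upto_upd => //; lia].
Qed.

Lemma torus_int_from_lincomb (n i : nat) c (F G : (nat -> C) -> C) z : (i + n = S d)%nat ->
  approx d (supp_upto (S d)) (torus_upto (S d)) F ->
  approx d (supp_upto (S d)) (torus_upto (S d)) G -> torus_upto i z ->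
  torus_int_from eps i n (fun z => c * F z + G z)%C z =
  (c * torus_int_from eps i n F z + torus_int_from eps i n G z)%C.
Proof.
elim: n i z => [|n IH] i z Hi HF HG Hz //=.
have HF' := torus_int_from_approx n (S i) F ltac:(lia) HF.
have HG' := torus_int_from_approx n (S i) G ltac:(lia) HG.
have [HF1 _] := contour_approx i _ ltac:(lia) HF'.
have [HG1 _] := contour_approx i _ ltac:(lia) HG'.
have [_ <-] := contour_lincomb (eps i) c _ _ (HF1 z Hz) (HG1 z Hz).
by apply: contour_int_ext => t; apply: IH => //; [lia | apply: torus_upto_upd => //; lia].
Qed.

(** [B] is a product of radii; since it is chosen before [F], limits can be taken under the
    integral. *)
Lemma torus_int_from_bound (n i : nat) : (i + n = S d)%nat ->
  exists B, 0 <= B /\ forall F M z,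
  approx d (supp_upto (S d)) (torus_upto (S d)) F ->
  (forall z, torus_upto (S d) z -> Cmod (F z) <= M) -> torus_upto i z ->
  Cmod (torus_int_from eps i n F z) <= B * M.
Proof.
elim: n i => [|n IH] i Hi.
  exists 1; split; first lra.
  move=> F M z _ HM Hz /=; rewrite Rmult_1_l; apply: HM.
  by have <- : i = S d by lia.
have [B [HB H]] := IH (S i) ltac:(lia).
have He := eps_pos i ltac:(lia).
exists (eps i * B); split; first by apply: Rmult_le_pos; lra.
move=> F M z HF HM Hz /=; rewrite Rmult_assoc; apply: contour_int_bound => //.
  have HF' := torus_int_from_approx n (S i) F ltac:(lia) HF.
  by have [HF1 _] := contour_approx i _ ltac:(lia) HF'; apply: HF1.
by move=> t; apply: H => //; apply: torus_upto_upd => //; lia.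
Qed.

Lemma torus_int_from_mon (n i : nat) (e : nat -> Z) z : (i + n = S d)%nat ->
  torus_int_from eps i n (mon d e) z =
  ((if forallb (fun k => (e k =? -1)%Z) (seq i n) then RtoC 1 else RtoC 0)
   * mon d (fun k => if (k <? i)%nat then e k else 0%Z) z)%C.
Proof.
elim: n i z => [|n IH] i z Hi.
  rewrite /= Cmult_1_l; apply: Cprod_ext => k Hk.
  by have -> : (k <? i)%nat = true by apply/Nat.ltb_lt; lia.
cbn [torus_int_from seq forallb].
have Hr := eps_pos i ltac:(lia).
set b := forallb _ (seq (S i) n).
set e' := fun k => if (k <? i)%nat then e k else 0%Z.
have [H1 H2] := contour_Czpow (eps i) (e i) Hr.
have [_ H3] := contour_scal (eps i) ((if b then RtoC 1 else RtoC 0) * mon d e' z)%C _ H1.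
transitivity (contour_int (eps i)
  (fun w => (if b then RtoC 1 else RtoC 0) * mon d e' z * Czpow w (e i))%C).
  apply: contour_int_ext => t; rewrite IH; last lia. rewrite mon_upd; last lia.
  have -> : (i <? S i)%nat = true by apply/Nat.ltb_lt; lia.
  have -> : (fun k => if (k =? i)%nat then 0%Z else if (k <? S i)%nat then e k else 0%Z) = e'.
    apply: functional_extensionality => k; rewrite /e'.
    case: Nat.eqb_spec => [->|E]; first by rewrite Nat.ltb_irrefl.
    by case: Nat.ltb_spec; case: Nat.ltb_spec => //; lia.
  rewrite -/b; ring.
rewrite H3 H2; case: Z.eqb => /=; ring.
Qed.

Definition torus (z : nat -> C) : Prop := forall k, (k <= d)%nat -> Cmod (z k) = eps k.

Lemma approx_torus_upto (D : (nat -> Z) -> Prop) F : approx d D torus F ->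
  approx d (supp_upto (S d)) (torus_upto (S d)) F.
Proof.
apply: approx_sub.
- by move=> e _ k; lia.
- move=> z Hz k Hk; apply: Hz; lia.
Qed.

Lemma torus_int_ext (F G : (nat -> C) -> C) : (forall z, torus z -> F z = G z) ->
  torus_int eps d F = torus_int eps d G.
Proof.
move=> H; apply: torus_int_from_ext => //; last by move=> k; lia.
move=> z Hz; apply: H => k Hk; apply: Hz; lia.
Qed.

Lemma torus_int_lincomb c (D D' : (nat -> Z) -> Prop) (F G : (nat -> C) -> C) :
  approx d D torus F -> approx d D' torus G ->
  torus_int eps d (fun z => c * F z + G z)%C = (c * torus_int eps d F + torus_int eps d G)%C.
Proof.
move=> HF HG; apply: torus_int_from_lincomb => //; last by move=> k; lia.
- exact: approx_torus_upto HF.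
- exact: approx_torus_upto HG.
Qed.

Lemma torus_int_bound : exists B, 0 <= B /\ forall (D : (nat -> Z) -> Prop) F M,
  approx d D torus F -> (forall z, torus z -> Cmod (F z) <= M) ->
  Cmod (torus_int eps d F) <= B * M.
Proof.
have [B [HB H]] := torus_int_from_bound (S d) 0 eq_refl.
exists B; split=> // D F M HF HM; apply: H => //; last by move=> k; lia.
- exact: approx_torus_upto HF.
- move=> z Hz; apply: HM => k Hk; apply: Hz; lia.
Qed.

Lemma torus_int_mon (e : nat -> Z) :
  torus_int eps d (mon d e) =
  if forallb (fun k => (e k =? -1)%Z) (seq 0 (S d)) then RtoC 1 else RtoC 0.
Proof.
rewrite /torus_int torus_int_from_mon //.
suff -> : mon d (fun k : nat => if (k <? 0)%nat then e k else 0%Z) (fun _ => RtoC 0) = 1.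
  by rewrite Cmult_1_r.
exact: Cprod_eq_1.
Qed.

End Torus.

(** * Integrals over the whole torus: independence of the radii and vanishing *)

Lemma approx_mon (d : nat) (D : (nat -> Z) -> Prop) X (e : nat -> Z) :
  D e -> approx d D X (mon d e).
Proof.
move=> He delta Hd; exists (fun z => 1 * mon d e z + 0)%C; split.
  by constructor=> //; constructor.
move=> z _; replace (_ - _)%C with (RtoC 0) by ring. rewrite Cmod_0; lra.
Qed.

Lemma approx_laurent (d : nat) (D : (nat -> Z) -> Prop) X P :
  laurent d D P -> approx d D X P.
Proof.
move=> HP delta Hd; exists P; split=> // z _.
replace (_ - _)%C with (RtoC 0) by ring. rewrite Cmod_0; lra.
Qed.

Lemma torus_int_const_0 (d : nat) (eps : nat -> R) :
  (forall i, (i <= d)%nat -> 0 < eps i) -> torus_int eps d (fun _ => RtoC 0) = 0.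
Proof.
move=> He.
have A := approx_laurent d (fun _ => True) (torus d eps) _ (laurent_0 d _).
(* By linearity the integral [I] of 0 satisfies [I = - I + I]. *)
transitivity (torus_int eps d (fun _ => RtoC (-1) * RtoC 0 + RtoC 0)%C).
  by apply: torus_int_ext => // z _; ring.
rewrite (torus_int_lincomb d eps He _ _ _ _ _ A A); ring.
Qed.

(* The integral of a Laurent polynomial is a coefficient, hence independent of the radii. *)
Lemma torus_int_laurent_indep (d : nat) (eps eps' : nat -> R) D P :
  (forall i, (i <= d)%nat -> 0 < eps i) -> (forall i, (i <= d)%nat -> 0 < eps' i) ->
  laurent d D P -> torus_int eps d P = torus_int eps' d P.
Proof.
move=> He He'; elim=> [|c e Q Hee HQ IH].
  by rewrite !torus_int_const_0.
have E : forall ep, (forall i, (i <= d)%nat -> 0 < ep i) ->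
    torus_int ep d (fun z => c * mon d e z + Q z)%C =
    (c * torus_int ep d (mon d e) + torus_int ep d Q)%C.
  move=> ep Hep; apply: (torus_int_lincomb d ep Hep c D D).
    exact: approx_mon.
  exact: approx_laurent.
rewrite (E eps He) (E eps' He') IH !torus_int_mon //.
Qed.

Lemma torus_int_laurent_0 (d : nat) (eps : nat -> R) D P :
  (forall i, (i <= d)%nat -> 0 < eps i) ->
  (forall e, D e -> exists i, (i <= d)%nat /\ e i <> (-1)%Z) ->
  laurent d D P -> torus_int eps d P = 0.
Proof.
move=> He HD; elim=> [|c e Q Hee HQ IH].
  exact: torus_int_const_0.
rewrite (torus_int_lincomb _ _ _ _ D D) //; [|by apply: approx_mon | by apply: approx_laurent].
rewrite IH torus_int_mon //.
case E : forallb; last by ring.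
have [i [Hi Hei]] := HD e Hee.
move/forallb_forall: E => /(_ i); rewrite in_seq => /(_ ltac:(lia)) /Z.eqb_eq; lia.
Qed.

Lemma Cmod_small (x : C) (B : R) : 0 <= B ->
  (forall delta, 0 < delta -> Cmod x <= B * delta) -> x = 0.
Proof.
move=> HB H; apply: Cmod_eq_0.
have Hx := Cmod_ge_0 x.
case: (Req_dec (Cmod x) 0) => // Hx0.
have := H (Cmod x / (2 * (B + 1))) ltac:(apply: Rdiv_lt_0_compat; lra).
have : B * (Cmod x / (2 * (B + 1))) <= Cmod x / 2.
  replace (Cmod x / 2) with ((B + 1) * (Cmod x / (2 * (B + 1)))) by (field; lra).
  apply: Rmult_le_compat_r; last lra.
  apply: Rlt_le; apply: Rdiv_lt_0_compat; lra.
lra.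
Qed.

Lemma torus_int_minus (d : nat) (eps : nat -> R) D D' (F G : (nat -> C) -> C) :
  (forall i, (i <= d)%nat -> 0 < eps i) ->
  approx d D (torus d eps) F -> approx d D' (torus d eps) G ->
  torus_int eps d (fun z => F z - G z)%C = (torus_int eps d F - torus_int eps d G)%C.
Proof.
move=> He HF HG.
transitivity (torus_int eps d (fun z => RtoC (-1) * G z + F z)%C).
  by apply: torus_int_ext => // z _; ring.
by rewrite (torus_int_lincomb _ _ _ _ D' D) //; ring.
Qed.

Lemma approx_minus (d : nat) D X (F G : (nat -> C) -> C) :
  approx d D X F -> approx d D X G -> approx d D X (fun z => F z - G z)%C.
Proof.
move=> HF HG delta Hd.
have [P [HP HFP]] := HF (delta / 2) ltac:(lra).
have [Q [HQ HGQ]] := HG (delta / 2) ltac:(lra).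
exists (fun z => P z - Q z)%C; split.
  have HQ' : laurent d D (fun z => - Q z)%C.
    elim: {HGQ}HQ => [|c e Q0 He _ IH].
      by have -> : (fun _ : nat -> C => (- 0)%C) = (fun _ => RtoC 0);
        [apply: functional_extensionality => z; ring | constructor].
    have -> : (fun z => - (c * mon d e z + Q0 z))%C = (fun z => - c * mon d e z + - Q0 z)%C.
      by apply: functional_extensionality => z; ring.
    by constructor.
  elim: {HFP}HP => [|c e P0 He _ IH].
    by have -> : (fun z => 0 - Q z)%C = (fun z => - Q z)%C;
        [apply: functional_extensionality => z; ring |].
  have -> : (fun z => c * mon d e z + P0 z - Q z)%C = (fun z => c * mon d e z + (P0 z - Q z))%C.
    by apply: functional_extensionality => z; ring.
  by constructor.
move=> z Hz.
replace (_ - _)%C with ((F z - P z) + - (G z - Q z))%C by ring.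
apply: (Rle_trans _ _ _ (Cmod_triangle _ _)); rewrite Cmod_opp.
have := HFP z Hz; have := HGQ z Hz; lra.
Qed.

(** This replaces the deformation of contours. One Laurent polynomial has to approximate [F] on both
    tori at once, whence the common region [X]. *)
Lemma torus_int_indep (d : nat) (eps eps' : nat -> R) D X F :
  (forall i, (i <= d)%nat -> 0 < eps i) -> (forall i, (i <= d)%nat -> 0 < eps' i) ->
  (forall z, torus d eps z -> X z) -> (forall z, torus d eps' z -> X z) ->
  approx d D X F -> torus_int eps d F = torus_int eps' d F.
Proof.
move=> He He' HX HX' HF.
have [B [HB H]] := torus_int_bound d eps He.
have [B' [HB' H']] := torus_int_bound d eps' He'.
suff E : (torus_int eps d F - torus_int eps' d F)%C = 0.
  by rewrite -[RHS]Cplus_0_l -E; ring.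
apply: (Cmod_small _ (B + B')) => [|delta Hd]; first lra.
have [P [HP HFP]] := HF delta Hd.
have aF := approx_sub d D D X _ F (fun e h => h) HX HF.
have aF' := approx_sub d D D X _ F (fun e h => h) HX' HF.
have aP := fun Y => approx_laurent d D Y P HP.
have K := H D _ delta (approx_minus d D _ F P aF (aP _)) (fun z hz => HFP z (HX z hz)).
have K' := H' D _ delta (approx_minus d D _ F P aF' (aP _)) (fun z hz => HFP z (HX' z hz)).
rewrite (torus_int_minus d eps D D) // in K.
rewrite (torus_int_minus d eps' D D) // in K'.
rewrite -(torus_int_laurent_indep d eps eps' D P He He' HP) in K'.
replace (torus_int eps d F - torus_int eps' d F)%C with
  ((torus_int eps d F - torus_int eps d P) + - (torus_int eps' d F - torus_int eps d P))%C by ring.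
apply: (Rle_trans _ _ _ (Cmod_triangle _ _)); rewrite Cmod_opp; lra.
Qed.

Lemma torus_int_0 (d : nat) (eps : nat -> R) D F :
  (forall i, (i <= d)%nat -> 0 < eps i) ->
  (forall e, D e -> exists i, (i <= d)%nat /\ e i <> (-1)%Z) ->
  approx d D (torus d eps) F -> torus_int eps d F = 0.
Proof.
move=> He HD HF.
have [B [HB H]] := torus_int_bound d eps He.
apply: (Cmod_small _ B) => // delta Hd.
have [P [HP HFP]] := HF delta Hd.
have aP := approx_laurent d D (torus d eps) P HP.
have K := H D _ delta (approx_minus d D _ F P HF aP) HFP.
rewrite (torus_int_minus d eps D D) // (torus_int_laurent_0 d eps D P) // in K.
by replace (torus_int eps d F) with (torus_int eps d F - 0)%C by ring.
Qed.

(** * The weight filtration *)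

Lemma approx_lim (d : nat) D X F :
  (forall delta, 0 < delta -> exists G, approx d D X G /\
     forall z, X z -> Cmod (F z - G z)%C <= delta) -> approx d D X F.
Proof.
move=> H delta Hd.
have [G [HG HFG]] := H (delta / 2) ltac:(lra).
have [P [HP HGP]] := HG (delta / 2) ltac:(lra).
exists P; split=> // z Hz.
replace (F z - P z)%C with ((F z - G z) + (G z - P z))%C by ring.
apply: (Rle_trans _ _ _ (Cmod_triangle _ _)).
have := HFG z Hz; have := HGP z Hz; lra.
Qed.

(** Bounds away from 0 and from infinity keep monomials with exponents of either sign bounded. *)
Definition annular (d : nat) (X : (nat -> C) -> Prop) : Prop :=
  exists a b, 0 < a /\ forall z i, X z -> (i <= d)%nat -> a <= Cmod (z i) <= b.

Lemma mon_add (d : nat) (e e' : nat -> Z) (z : nat -> C) :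
  (forall i, (i <= d)%nat -> z i <> 0) ->
  mon d (fun i => e i + e' i)%Z z = (mon d e z * mon d e' z)%C.
Proof.
move=> Hz; rewrite /mon -Cprod_mult; apply: Cprod_ext => k Hk.
by apply: Czpow_add; apply: Hz; lia.
Qed.

Definition delta (i : nat) (v : Z) : nat -> Z := fun k => if (k =? i)%nat then v else 0%Z.

Lemma mon_delta (d i : nat) (v : Z) (z : nat -> C) : (i <= d)%nat ->
  mon d (delta i v) z = Czpow (z i) v.
Proof.
move=> Hi; have E : z = upd z i (z i).
  by apply: functional_extensionality => k; rewrite /upd; case: Nat.eqb_spec => [->|].
rewrite {1}E mon_upd // /delta Nat.eqb_refl.
suff -> : mon d (fun k => if (k =? i)%nat then 0%Z else if (k =? i)%nat then v else 0%Z) z = 1.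
  by rewrite Cmult_1_r.
by apply: Cprod_eq_1 => k Hk; case: Nat.eqb.
Qed.

Lemma Czpow_bound (a b : R) (n : Z) : 0 < a -> exists M, 0 <= M /\ forall z, a <= Cmod z <= b ->
  Cmod (Czpow z n) <= M.
Proof.
move=> Ha.
have key : forall k z, a <= Cmod z <= b -> Cmod z ^ k <= (Rabs b + 1) ^ k.
  move=> k z Hz; apply: pow_incr; split; first exact: Cmod_ge_0.
  have := Rle_abs b; lra.
have key0 : forall k, 0 <= (Rabs b + 1) ^ k.
  by move=> k; apply: pow_le; have := Rabs_pos b; lra.
case: n => [|p|p] /=.
- by exists 1; split=> [|z _]; [lra | rewrite Cmod_1; lra].
- by exists ((Rabs b + 1) ^ Pos.to_nat p); split=> // z Hz; rewrite Cmod_pow; apply: key.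
- exists ((/ a) ^ Pos.to_nat p); split.
    by apply: pow_le; left; apply: Rinv_0_lt_compat.
  move=> z Hz; have Hz0 : z <> 0 by rewrite Cmod_gt_0; lra.
  rewrite Cmod_inv; last exact: Cpow_nz.
  rewrite Cmod_pow -pow_inv; apply: pow_incr; split.
    left; apply: Rinv_0_lt_compat; lra.
  apply: Rinv_le_contravar; lra.
Qed.

Lemma mon_bounded (d : nat) X (e : nat -> Z) : annular d X ->
  exists M, 0 <= M /\ forall z, X z -> Cmod (mon d e z) <= M.
Proof.
move=> [a [b [Ha HX]]]; rewrite /mon.
have : forall i, (i <= d)%nat -> forall z, X z -> a <= Cmod (z i) <= b.
  by move=> i Hi z Hz; apply: HX.
elim: d {HX} => [|n IH] HX.
  have [M [HM H]] := Czpow_bound a b (e 0%nat) Ha.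
  by exists M; split=> // z Hz; rewrite Cprod_1; apply: H; apply: HX.
have [M [HM H]] := IH (fun i Hi => HX i ltac:(lia)).
have [M' [HM' H']] := Czpow_bound a b (e (S n)) Ha.
exists (M * M'); split; first exact: Rmult_le_pos.
move=> z Hz; rewrite Cprod_recr; last lia.
rewrite Cmod_mult; apply: Rmult_le_compat; try exact: Cmod_ge_0.
  exact: H.
by apply: H'; apply: HX.
Qed.

Lemma approx_bounded (d : nat) D X F : annular d X -> approx d D X F ->
  exists M, 0 <= M /\ forall z, X z -> Cmod (F z) <= M.
Proof.
move=> HX HF.
have [P [HP HFP]] := HF 1 Rlt_0_1.
have [M [HM HPM]] : exists M, 0 <= M /\ forall z, X z -> Cmod (P z) <= M.
  elim: {HFP} HP => [|c e Q _ _ [M [HM IH]]].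
    by exists 0; split=> [|z _]; [lra | rewrite Cmod_0; lra].
  have [M' [HM' H']] := mon_bounded d X e HX.
  exists (Cmod c * M' + M); split.
    by have := Rmult_le_pos _ _ (Cmod_ge_0 c) HM'; lra.
  move=> z Hz; apply: (Rle_trans _ _ _ (Cmod_triangle _ _)); rewrite Cmod_mult.
  apply: Rplus_le_compat; last exact: IH.
  apply: Rmult_le_compat_l; [exact: Cmod_ge_0 | exact: H'].
exists (M + 1); split; first lra.
move=> z Hz; replace (F z) with ((F z - P z) + P z)%C by ring.
apply: (Rle_trans _ _ _ (Cmod_triangle _ _)).
have := HPM z Hz; have := HFP z Hz; lra.
Qed.

Ltac solve_delta := rewrite /delta; repeat case: Nat.eqb_spec; lia.

Section Filtration.

Variables (d : nat) (lam : (nat -> Z) -> Z) (X : (nat -> C) -> Prop).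
Hypothesis lam_add : forall e e', lam (fun i => e i + e' i)%Z = (lam e + lam e')%Z.
Hypothesis annX : annular d X.

(* [F] is a uniform limit on [X] of Laurent polynomials all of whose monomials have weight
   [lam e >= c].  For [lam e = e_k] this records the order of vanishing in [z_k], for
   [lam e = e_0 + e_k] the joint order in [(z_0, z_k)]; products add the weights. *)
Definition filt (c : Z) (F : (nat -> C) -> C) : Prop :=
  approx d (fun e => (c <= lam e)%Z) X F.

Lemma lam_0 : lam (fun _ => 0%Z) = 0%Z.
Proof. have := lam_add (fun _ => 0%Z) (fun _ => 0%Z); rewrite /=; lia. Qed.

Lemma filt_weaken (c c' : Z) F : (c' <= c)%Z -> filt c F -> filt c' F.
Proof. by move=> Hc; apply: approx_sub => // e; lia. Qed.

Lemma filt_ext (c : Z) F G : (forall z, X z -> F z = G z) -> filt c F -> filt c G.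
Proof. exact: approx_ext. Qed.

Lemma annular_neq_0 z i : X z -> (i <= d)%nat -> z i <> 0.
Proof. by case: annX => a [b [Ha H]] Hz Hi; rewrite Cmod_gt_0; have := H z i Hz Hi; lra. Qed.

Lemma filt_const (c : Z) (k : C) : (c <= 0)%Z -> filt c (fun _ => k).
Proof.
move=> Hc; apply: (approx_laurent d _ X (fun _ => k)).
have E : (fun _ => k) = (fun z => k * mon d (fun _ => 0%Z) z + 0)%C.
  by apply: functional_extensionality => z; rewrite /mon Cprod_eq_1 //; ring.
rewrite E; constructor; last by constructor.
by rewrite lam_0.
Qed.

Lemma filt_Czpow (c : Z) (i : nat) (v : Z) : (i <= d)%nat -> (c <= lam (delta i v))%Z ->
  filt c (fun z => Czpow (z i) v).
Proof.
move=> Hi Hc.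
have -> : (fun z : nat -> C => Czpow (z i) v) = mon d (delta i v).
  by apply: functional_extensionality => z; rewrite mon_delta.
exact: approx_mon.
Qed.

Lemma filt_coord (c : Z) (i : nat) : (i <= d)%nat -> (c <= lam (delta i 1))%Z ->
  filt c (fun z => z i).
Proof.
move=> Hi Hc; apply: filt_ext (filt_Czpow c i 1 Hi Hc) => z _ /=.
by rewrite Cmult_1_r.
Qed.

Lemma filt_coord_inv (c : Z) (i : nat) : (i <= d)%nat -> (c <= lam (delta i (-1)))%Z ->
  filt c (fun z => / z i)%C.
Proof.
move=> Hi Hc; apply: filt_ext (filt_Czpow c i (-1) Hi Hc) => z _ /=.
by rewrite Cmult_1_r.
Qed.

Lemma filt_minus (c : Z) F G : filt c F -> filt c G -> filt c (fun z => F z - G z)%C.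
Proof. exact: approx_minus. Qed.

Lemma filt_plus (c : Z) F G : filt c F -> filt c G -> filt c (fun z => F z + G z)%C.
Proof.
move=> HF HG.
have H0 : filt c (fun _ => RtoC 0) by apply: approx_laurent; constructor.
apply: filt_ext (filt_minus c _ _ HF (filt_minus c _ _ H0 HG)) => z _; ring.
Qed.

Lemma filt_mult (a b c : Z) F G : (c <= a + b)%Z -> filt a F -> filt b G ->
  filt c (fun z => F z * G z)%C.
Proof.
move=> Hc HF HG e He.
have [MF [HMF HF0]] := approx_bounded d _ X F annX HF.
have [MG [HMG HG0]] := approx_bounded d _ X G annX HG.
have He1 : 0 < e / (2 * (MG + 1)) by apply: Rdiv_lt_0_compat; lra.
have He2 : 0 < e / (2 * (MF + 1)) by apply: Rdiv_lt_0_compat; lra.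
(* In [F G - P Q = (F - P) G + P (G - Q)] the factor [P] must be bounded too; the cap 1 gives
   [|P| <= MF + 1]. *)
have [P [HP HFP]] := HF (Rmin 1 (e / (2 * (MG + 1)))) ltac:(apply: Rmin_pos; lra).
have [Q [HQ HGQ]] := HG _ He2.
have [R [HR HPQ]] : exists R, laurent d (fun e => (c <= lam e)%Z) R /\
    forall z, X z -> R z = (P z * Q z)%C.
  elim: {HFP} HP => [|k1 e1 P1 He1' _ [R1 [HR1 IH1]]].
    by exists (fun _ => RtoC 0); split; [constructor | move=> z _; ring].
  suff [R2 [HR2 IH2]] : exists R, laurent d (fun e => (c <= lam e)%Z) R /\
      forall z, X z -> R z = (k1 * mon d e1 z * Q z + R1 z)%C.
    by exists R2; split=> // z Hz; rewrite IH2 // IH1 //; ring.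
  elim: {HGQ} HQ => [|k2 e2 Q1 He2' _ [R3 [HR3 IH3]]].
    by exists R1; split=> // z _; ring.
  exists (fun z => (k1 * k2) * mon d (fun i => e1 i + e2 i)%Z z + R3 z)%C; split.
    by constructor=> //; rewrite lam_add; lia.
  move=> z Hz; rewrite IH3 // mon_add; first ring.
  by move=> i Hi; apply: annular_neq_0.
exists R; split=> // z Hz; rewrite HPQ //.
replace (_ - _)%C with ((F z - P z) * G z + P z * (G z - Q z))%C by ring.
apply: (Rle_trans _ _ _ (Cmod_triangle _ _)); rewrite !Cmod_mult.
have K1 := HFP z Hz. have K2 := HGQ z Hz. have K3 := HF0 z Hz. have K4 := HG0 z Hz.
have L1 := Rmin_l 1 (e / (2 * (MG + 1))). have L2 := Rmin_r 1 (e / (2 * (MG + 1))).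
have K5 : Cmod (P z) <= MF + 1.
  replace (P z) with (F z + - (F z - P z))%C by ring.
  apply: (Rle_trans _ _ _ (Cmod_triangle _ _)); rewrite Cmod_opp; lra.
have E1 : Cmod (F z - P z)%C * Cmod (G z) <= e / (2 * (MG + 1)) * (MG + 1).
  apply: Rmult_le_compat; try exact: Cmod_ge_0; lra.
have E2 : Cmod (P z) * Cmod (G z - Q z)%C <= (MF + 1) * (e / (2 * (MF + 1))).
  apply: Rmult_le_compat; try exact: Cmod_ge_0; lra.
replace e with (e / (2 * (MG + 1)) * (MG + 1) + (MF + 1) * (e / (2 * (MF + 1)))) by (field; lra).
lra.
Qed.

Lemma filt_scal (c : Z) (k : C) F : filt c F -> filt c (fun z => k * F z)%C.
Proof. by apply: filt_mult (filt_const 0 k _); lia. Qed.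

Lemma filt_pow (c : Z) (n : nat) F : filt c F -> filt (Z.of_nat n * c) (fun z => F z ^ n)%C.
Proof.
move=> HF; elim: n => [|n IH]; first exact: filt_const.
apply: (filt_ext _ (fun z => F z * F z ^ n)%C); first by move=> z _; rewrite Cpow_S.
by apply: filt_mult HF IH; lia.
Qed.

Lemma filt_Cprod (c : Z) (m n : nat) (F : nat -> (nat -> C) -> C) :
  (forall l, (m <= l <= n)%nat -> filt c (F l)) ->
  filt (Z.of_nat (S n - m) * c) (fun z => Cprod (fun l => F l z) m n).
Proof.
case: (le_lt_dec m n) => [H|H]; last first.
  move=> _; apply: (filt_ext _ (fun _ => RtoC 1)).
    by move=> z _; rewrite Cprod_nil.
  apply: filt_const; have -> : (S n - m = 0)%nat by lia. 
  by lia.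
have [k ->] : exists k, n = (m + k)%nat by exists (n - m)%nat; lia.
elim: k {H} => [|k IH] Hf.
  apply: (filt_ext _ (F m)).
    by move=> z _; rewrite Nat.add_0_r Cprod_1.
  apply: filt_weaken (Hf m _); last lia. nia.
apply: (filt_ext _ (fun z => Cprod (fun l => F l z) m (m + k) * F (m + S k)%nat z)%C).
  by move=> z _; rewrite Nat.add_succ_r Cprod_recr //; lia.
apply: (filt_mult (Z.of_nat (S (m + k) - m) * c) c); last (by apply: Hf; lia).
  nia.
by apply: IH => l Hl; apply: Hf; lia.
Qed.

Lemma filt_pow_0 (n : nat) F : filt 0 F -> filt 0 (fun z => F z ^ n)%C.
Proof. by move=> HF; apply: filt_weaken (filt_pow 0 n F HF); lia. Qed.

Lemma filt_Cprod_0 (m n : nat) (F : nat -> (nat -> C) -> C) :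
  (forall l, (m <= l <= n)%nat -> filt 0 (F l)) ->
  filt 0 (fun z => Cprod (fun l => F l z) m n).
Proof. by move=> HF; apply: filt_weaken (filt_Cprod 0 m n F HF); lia. Qed.

(* [/ (B - A)] is [/ B] times the geometric series of ratio [A / B]. *)
Lemma filt_inv_minus (a b c : Z) (rho : R) (A B : (nat -> C) -> C) :
  (c <= b)%Z -> (0 <= a + b)%Z -> rho < 1 ->
  (forall z, X z -> B z <> 0 /\ Cmod (A z) <= rho * Cmod (B z)) ->
  filt a A -> filt b (fun z => / B z)%C -> filt c (fun z => / (B z - A z))%C.
Proof.
move=> Hcb Hab Hrho HAB HA HB.
set H := fun z => (A z * / B z)%C.
have HH : filt 0 H by apply: filt_mult HA HB.
have Hmod : forall z, X z -> Cmod (H z) <= rho.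
  move=> z Hz; have [H1 H2] := HAB z Hz.
  have Hp : 0 < Cmod (B z) by rewrite -Cmod_gt_0.
  rewrite /H Cmod_mult Cmod_inv //; apply: (Rmult_le_reg_r (Cmod (B z))) => //.
  by rewrite Rmult_assoc Rinv_l; lra.
have Hne : forall z, X z -> (1 - H z)%C <> 0 /\ 1 - rho <= Cmod (1 - H z)%C.
  move=> z Hz; have K : 1 - rho <= Cmod (1 - H z)%C.
    have := Cmod_triangle (1 - H z)%C (H z).
    replace (1 - H z + H z)%C with (RtoC 1) by ring.
    rewrite Cmod_1; have := Hmod z Hz; lra.
  by split=> //; rewrite Cmod_gt_0; lra.
have Hgeo : filt 0 (fun z => / (1 - H z))%C.
  (* A negative [rho] would bound a modulus, so [X] is then empty. *)
  case: (Rle_lt_dec 0 rho) => [Hr0|Hr0]; last first.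
    apply: (filt_ext _ (fun _ => RtoC 0)); last exact: filt_const.
    move=> z Hz; have := Hmod z Hz; have := Cmod_ge_0 (H z); lra.
  apply: approx_lim => e He.
  have He' : 0 < e * (1 - rho) by apply: Rmult_lt_0_compat; lra.
  (* The remainder of the series is [H^n / (1 - H)], where [|1 - H| >= 1 - rho]. *)
  have [n Hn] := pow_lt_1_zero rho ltac:(by rewrite Rabs_pos_eq) _ He'.
  have {}Hn := Hn n (le_n _).
  have [S [HS HS']] : exists S, filt 0 S /\ forall z, ((1 - H z) * S z = 1 - H z ^ n)%C.
    elim: {Hn} n => [|n [S [HS IH]]].
      exists (fun _ => RtoC 0); split; first exact: filt_const.
      by move=> z /=; ring.
    exists (fun z => H z * S z + 1)%C; split.
      apply: filt_plus; [exact: filt_mult HH HS | exact: filt_const].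
    move=> z; rewrite Cpow_S; transitivity (H z * ((1 - H z) * S z) + (1 - H z))%C; first ring.
    rewrite IH; ring.
  exists S; split=> // z Hz; have [H1 H2] := Hne z Hz.
  have -> : (/ (1 - H z) - S z)%C = (H z ^ n / (1 - H z))%C.
    have E : (H z ^ n)%C = (1 - (1 - H z) * S z)%C.
      by rewrite HS'; move: (H z ^ n)%C => x; ring.
    by rewrite E; move: (H z) H1 => x Hx; field.
  rewrite Cmod_div // Cmod_pow.
  have Hp : 0 < Cmod (1 - H z)%C by lra.
  apply: (Rmult_le_reg_r (Cmod (1 - H z)%C)) => //.
  rewrite /Rdiv Rmult_assoc Rinv_l; last lra.
  rewrite Rmult_1_r.
  have K1 : Cmod (H z) ^ n <= rho ^ n.
    by apply: pow_incr; split; [exact: Cmod_ge_0 | exact: Hmod].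
  have K2 := Rle_abs (rho ^ n).
  have K3 : e * (1 - rho) <= e * Cmod (1 - H z)%C by apply: Rmult_le_compat_l; lra.
  lra.
apply: (filt_ext _ (fun z => / (1 - H z) * / B z)%C).
  move=> z Hz; have [H1 _] := HAB z Hz; have [H2 _] := Hne z Hz.
  have H3 : (B z - A z)%C <> 0.
    move=> E; apply: H2; rewrite /H.
    have -> : A z = B z by rewrite -[LHS]Cplus_0_l -E; ring.
    by rewrite Cinv_r //; ring.
  rewrite /H; field; split=> //; split=> //.
by apply: filt_mult Hgeo HB; lia.
Qed.

End Filtration.

Definition box (d : nat) (lo hi : nat -> R) (z : nat -> C) : Prop :=
  forall i, (i <= d)%nat -> lo i <= Cmod (z i) <= hi i.

Lemma annular_box (d : nat) (lo hi : nat -> R) :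
  (forall i, (i <= d)%nat -> 0 < lo i) -> annular d (box d lo hi).
Proof.
move=> Hlo.
suff [a [b [Ha H]]] : exists a b, 0 < a /\ forall i, (i <= d)%nat -> a <= lo i /\ hi i <= b.
  exists a, b; split=> // z i Hz Hi; have := H i Hi; have := Hz i Hi; lra.
elim: d Hlo => [|n IH] Hlo.
  exists (lo 0%nat), (hi 0%nat); split; first exact: Hlo.
  move=> i Hi; have -> : i = 0%nat by lia.
  lra.
have [a [b [Ha H]]] := IH (fun i Hi => Hlo i ltac:(lia)).
exists (Rmin a (lo (S n))), (Rmax b (hi (S n))); split.
  by apply: Rmin_pos => //; apply: Hlo.
move=> i Hi; have L1 := Rmin_l a (lo (S n)); have L2 := Rmin_r a (lo (S n)).
have L3 := Rmax_l b (hi (S n)); have L4 := Rmax_r b (hi (S n)).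
case: (Nat.eq_dec i (S n)) => [->|Hn]; first lra.
have := H i ltac:(lia); lra.
Qed.

Lemma torus_box (d : nat) (eps lo hi : nat -> R) z :
  (forall i, (i <= d)%nat -> lo i <= eps i <= hi i) -> torus d eps z -> box d lo hi z.
Proof. by move=> H Hz i Hi; rewrite Hz //; apply: H. Qed.

Lemma annular_torus (d : nat) (eps : nat -> R) :
  (forall i, (i <= d)%nat -> 0 < eps i) -> annular d (torus d eps).
Proof.
move=> H; have [a [b [Ha Hab]]] := annular_box d eps eps H.
exists a, b; split=> // z i Hz Hi; apply: Hab => //.
by apply: torus_box Hz => j Hj; lra.
Qed.

Lemma filt_sub (d : nat) lam X X' c F :
  (forall z, X' z -> X z) -> filt d lam X c F -> filt d lam X' c F.
Proof. by apply: approx_sub. Qed.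

(** The coordinate [z_i] dominates, so the inverse expands in [z_i^(-1)] times powers of [z_p / z_i]
    and [z_q / z_i]; the last two weight conditions say that these ratios do not lower the
    weight. *)
Lemma filt_inv_linear (d : nat) lam (lo hi : nat -> R) (alpha b1 b2 : R) (i p q : nat) (c : Z) :
  (forall e e', lam (fun i => e i + e' i)%Z = (lam e + lam e')%Z) ->
  (forall i, (i <= d)%nat -> 0 < lo i) ->
  (i <= d)%nat -> (p <= d)%nat -> (q <= d)%nat -> 0 < alpha ->
  Rabs b1 * hi p + Rabs b2 * hi q < alpha * lo i ->
  (c <= lam (delta i (-1)))%Z ->
  (0 <= lam (delta p 1) + lam (delta i (-1)))%Z ->
  (0 <= lam (delta q 1) + lam (delta i (-1)))%Z ->
  filt d lam (box d lo hi) c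
    (fun z => / (RtoC alpha * z i - (RtoC b1 * z p + RtoC b2 * z q)))%C.
Proof.
move=> Hadd Hlo Hi Hp Hq Ha Hdom Hc Hlp Hlq.
have annX := annular_box d lo hi Hlo.
have Hai : 0 < alpha * lo i by apply: Rmult_lt_0_compat => //; apply: Hlo.
have HaC : RtoC alpha <> 0 by move/RtoC_inj; lra.
apply: (filt_inv_minus d lam _ Hadd annX (- lam (delta i (-1))) (lam (delta i (-1)))
  c ((Rabs b1 * hi p + Rabs b2 * hi q) / (alpha * lo i))
  (fun z => RtoC b1 * z p + RtoC b2 * z q)%C (fun z => RtoC alpha * z i)%C) => //; try lia.
- apply: (Rmult_lt_reg_r (alpha * lo i)) => //.
  by rewrite /Rdiv Rmult_assoc Rinv_l; lra.
- move=> z Hz; split.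
    apply: Cmult_neq_0 => //; exact: (annular_neq_0 d _ annX).
  have H1 := Hz i Hi; have H2 := Hz p Hp; have H3 := Hz q Hq.
  apply: (Rle_trans _ (Rabs b1 * hi p + Rabs b2 * hi q)).
    apply: (Rle_trans _ _ _ (Cmod_triangle _ _)); rewrite !Cmod_mult !Cmod_R.
    apply: Rplus_le_compat; (apply: Rmult_le_compat_l; [exact: Rabs_pos | lra]).
  rewrite Cmod_mult Cmod_R (Rabs_pos_eq alpha); last lra.
  have Hnn : 0 <= Rabs b1 * hi p + Rabs b2 * hi q.
    have := Rmult_le_pos _ _ (Rabs_pos b1) (Rle_trans _ _ _ (Cmod_ge_0 _) (proj2 H2)).
    have := Rmult_le_pos _ _ (Rabs_pos b2) (Rle_trans _ _ _ (Cmod_ge_0 _) (proj2 H3)).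
    lra.
  rewrite -{1}[Rabs b1 * hi p + Rabs b2 * hi q]Rmult_1_r /Rdiv Rmult_assoc.
  apply: Rmult_le_compat_l => //.
  apply: (Rmult_le_reg_l (alpha * lo i)) => //.
  rewrite -Rmult_assoc Rinv_r; last lra.
  have := Rmult_le_compat_l alpha _ _ ltac:(lra) (proj1 H1); lra.
- by apply: filt_plus => //; apply: filt_scal => //; apply: filt_coord => //; lia.
- apply: (filt_ext _ _ _ _ (fun z => RtoC (/ alpha) * / z i)%C).
    move=> z Hz; have Hz0 := annular_neq_0 d _ annX z i Hz Hi.
    rewrite RtoC_inv; last lra. by field.
  apply: filt_scal => //; apply: filt_coord_inv => //; lia.
Qed.

(** With this weight, [filt d lam0 X 0] just means being a uniform limit of Laurent polynomials on
    [X]. *)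
Definition lam0 (e : nat -> Z) : Z := 0%Z.

Lemma filt_lam0 (d : nat) lam X c F : filt d lam X c F -> filt d lam0 X 0 F.
Proof. by apply: approx_sub => // e _; rewrite /lam0; lia. Qed.

Lemma torus_int_lim_0 (d : nat) (eps : nat -> R) (F : (nat -> C) -> C) :
  (forall i, (i <= d)%nat -> 0 < eps i) ->
  (forall r, 0 < r -> exists G, filt d lam0 (torus d eps) 0 G /\ torus_int eps d G = 0 /\
     forall z, torus d eps z -> Cmod (F z - G z)%C <= r) ->
  filt d lam0 (torus d eps) 0 F /\ torus_int eps d F = 0.
Proof.
move=> He H.
have HF : filt d lam0 (torus d eps) 0 F.
  by apply: approx_lim => r Hr; have [G [HG [_ HFG]]] := H r Hr; exists G.
split=> //.
have [B [HB K]] := torus_int_bound d eps He.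
apply: (Cmod_small _ B) => // r Hr.
have [G [HG [HG0 HFG]]] := H r Hr.
have := K _ _ _ (approx_minus d _ _ F G HF HG) HFG.
rewrite (torus_int_minus d eps _ _ F G He HF HG) HG0.
by replace (torus_int eps d F - 0)%C with (torus_int eps d F) by ring.
Qed.

(** The vanishing criterion: only [prod_i 1 / z_i] has a nonzero integral, and its weight is too low
    to occur. Typical uses are weight [e_k] with [c = 0] (no pole in [z_k]) and weight [- e_k] with
    [c = 2] (decay of order [z_k^(-2)] at infinity). *)
Lemma filt_torus_int_0 (d : nat) (eps : nat -> R) lam c F :
  (forall i, (i <= d)%nat -> 0 < eps i) ->
  (forall e, (forall i, (i <= d)%nat -> e i = (-1)%Z) -> (lam e < c)%Z) ->
  filt d lam (torus d eps) c F ->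
  filt d lam0 (torus d eps) 0 F /\ torus_int eps d F = 0.
Proof.
move=> He Hlam HF; split; first exact: filt_lam0 HF.
apply: torus_int_0 HF => // e Hc.
have [H|H] := classic (exists i, (i <= d)%nat /\ e i <> (-1)%Z) => //.
suff : (lam e < c)%Z by lia.
apply: Hlam => i Hi; case: (Z.eq_dec (e i) (-1)) => // Hn; by case: H; exists i.
Qed.

(** Approximability travels together with vanishing because linearity of the integral is established
    for approximable functions. *)
Lemma torus_int_plus_0 (d : nat) (eps : nat -> R) c F G :
  (forall i, (i <= d)%nat -> 0 < eps i) ->
  filt d lam0 (torus d eps) 0 F /\ torus_int eps d F = 0 ->
  filt d lam0 (torus d eps) 0 G /\ torus_int eps d G = 0 ->
  filt d lam0 (torus d eps) 0 (fun z => c * F z + G z)%C /\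
  torus_int eps d (fun z => c * F z + G z)%C = 0.
Proof.
move=> He [HF HF0] [HG HG0]; split.
  apply: filt_plus => //; apply: filt_scal => //; exact: annular_torus.
by rewrite (torus_int_lincomb d eps He c _ _ F G HF HG) HF0 HG0; ring.
Qed.

Lemma torus_int_eq_0_ext (d : nat) (eps : nat -> R) F G :
  (forall i, (i <= d)%nat -> 0 < eps i) ->
  (forall z, torus d eps z -> F z = G z) ->
  filt d lam0 (torus d eps) 0 F /\ torus_int eps d F = 0 ->
  filt d lam0 (torus d eps) 0 G /\ torus_int eps d G = 0.
Proof.
move=> He H [HF HF0]; split; first exact: approx_ext HF.
by rewrite -(torus_int_ext d eps He F G).
Qed.

Lemma filt_Cprod_coord_inv (d : nat) lam X (n : nat) :
  (forall e e', lam (fun i => e i + e' i)%Z = (lam e + lam e')%Z) -> annular d X ->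
  (n <= d)%nat -> (forall l, (1 <= l <= n)%nat -> (0 <= lam (delta l (-1)))%Z) ->
  filt d lam X 0 (fun z => Cprod (fun l => / z l) 1 n)%C.
Proof.
move=> Hadd annX Hn H.
apply: (filt_Cprod_0 _ _ _ _ _ _ _ (fun l z => / z l)%C) => // l Hl.
by apply: filt_coord_inv; [lia | apply: H].
Qed.

(** * Elimination of one variable by its residue *)

Section Step.

Variables (d k : nat) (eps : nat -> R).
Hypothesis eps_pos : forall i, (i <= d)%nat -> 0 < eps i.
Hypothesis Hk : (1 <= k <= d - 1)%nat.
(** This inequality puts the pole [z_k = mid] inside the circle of [z_k]; the next one makes
    [z_{k+1}] dominate [z_0] in [mid]. *)
Hypothesis mid_small : eps 0%nat + INR k * eps (S k) < INR (S k) * eps k.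
Hypothesis eps0_small : eps 0%nat < INR k * eps (S k).

(* the value of [z_k] in arithmetic progression with [z_0] and [z_{k+1}] *)
Definition mid (z : nat -> C) : C :=
  (RtoC (/ INR (S k)) * z 0%nat + RtoC (INR k / INR (S k)) * z (S k))%C.

Let T := torus d eps.

Let Rk (z : nat -> C) : C := Cprod (fun l => / z l)%C 1 (k - 1).

Lemma INR_Sk_pos : 0 < INR (S k).
Proof. apply: lt_0_INR; lia. Qed.

Lemma INR_k_pos : 0 < INR k.
Proof. apply: lt_0_INR; lia. Qed.

Lemma mid_coefs_pos : 0 < / INR (S k) /\ 0 < INR k / INR (S k).
Proof.
have H1 := INR_Sk_pos; have H2 := INR_k_pos; split.
  exact: Rinv_0_lt_compat.
exact: Rdiv_lt_0_compat.
Qed.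

Lemma mid_dominated : / INR (S k) * eps 0%nat + INR k / INR (S k) * eps (S k) < 1 * eps k.
Proof.
have H1 := INR_Sk_pos.
apply: (Rmult_lt_reg_l (INR (S k))) => //.
replace (INR (S k) * (/ INR (S k) * eps 0%nat + INR k / INR (S k) * eps (S k)))
  with (eps 0%nat + INR k * eps (S k)) by (field; lra).
lra.
Qed.

Lemma box_torus z : T z -> box d eps eps z.
Proof. by move=> Hz; apply: torus_box Hz => i Hi; lra. Qed.

Lemma z_neq_mid z : T z -> (z k - mid z)%C <> 0.
Proof.
move=> Hz E.
have [P1 P2] := mid_coefs_pos.
have E' : z k = mid z by rewrite -[RHS]Cplus_0_l -E; ring.
have := mid_dominated; have <- := Hz k ltac:(lia).
rewrite E' /mid Rmult_1_l; apply: Rle_not_lt.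
apply: (Rle_trans _ _ _ (Cmod_triangle _ _)); rewrite !Cmod_mult !Cmod_R !Rabs_pos_eq; try lra.
rewrite Hz ?Hz; try lia; lra.
Qed.

Lemma filt_inv_z_minus_mid lam c :
  (forall e e', lam (fun i => e i + e' i)%Z = (lam e + lam e')%Z) ->
  (c <= lam (delta k (-1)))%Z ->
  (0 <= lam (delta 0 1) + lam (delta k (-1)))%Z ->
  (0 <= lam (delta (S k) 1) + lam (delta k (-1)))%Z ->
  filt d lam T c (fun z => / (z k - mid z))%C.
Proof.
move=> Hadd Hc H0 H1; have [P1 P2] := mid_coefs_pos.
apply: (filt_ext _ _ _ _ (fun z => / (RtoC 1 * z k - mid z))%C).
  by move=> z _; rewrite Cmult_1_l.
apply: (filt_sub _ _ _ _ _ _ box_torus).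
apply: filt_inv_linear => //; try lia; try lra.
rewrite !Rabs_pos_eq; try lra. exact: mid_dominated.
Qed.

Lemma filt_mid lam c :
  (forall e e', lam (fun i => e i + e' i)%Z = (lam e + lam e')%Z) ->
  (c <= lam (delta 0 1))%Z -> (c <= lam (delta (S k) 1))%Z -> filt d lam T c mid.
Proof.
move=> Hadd H0 H1; have annT := annular_torus d eps eps_pos.
by apply: filt_plus => //; apply: filt_scal => //; apply: filt_coord => //; lia.
Qed.

(** The second half integrates over [z_k] to [g] at [mid], which is the residue of the first half
    there; a zero integral of [Phi] says that, after integration over [z_0] as well, this residue is
    all that counts. *)
Let Phi (g : (nat -> C) -> C) (z : nat -> C) : C :=
  (Rk z * (g z * / (z k - mid z) - g (upd z k (mid z)) * / z k))%C.

(* If [e_k >= 0], the term [/ (z_k - mid)] has residue [mid ^ e_k] and the rest has no [/ z_k].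
   If [e_k < 0], the first half of [Phi] is [O(z_k ^ -2)] at infinity, and the second half is
   regular in [z_0] because [e_0 >= -1 - e_k >= 0]. *)
Lemma Phi_mon (e : nat -> Z) : (-1 <= e 0%nat + e k)%Z ->
  filt d lam0 T 0 (Phi (mon d e)) /\ torus_int eps d (Phi (mon d e)) = 0.
Proof.
move=> He; have annT := annular_torus d eps eps_pos.
set e' := fun l => if (l =? k)%nat then 0%Z else e l.
have monE : forall z, mon d e z = (Czpow (z k) (e k) * mon d e' z)%C.
  move=> z; rewrite -[RHS](mon_upd d k e z (z k)); last lia.
  congr mon; apply: functional_extensionality => l; rewrite /upd.
  by case: Nat.eqb_spec => [->|].
have monE' : forall z, mon d e (upd z k (mid z)) = (Czpow (mid z) (e k) * mon d e' z)%C.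
  by move=> z; rewrite mon_upd //; lia.
have He'k : e' k = 0%Z by rewrite /e' Nat.eqb_refl.
have He'0 : e' 0%nat = e 0%nat by rewrite /e'; case: Nat.eqb_spec => //; lia.
have Hznz : forall z, T z -> z k <> 0.
  by move=> z Hz; apply: (annular_neq_0 d T annT) => //; lia.
case: (Z_le_gt_dec 0 (e k)) => Hek.
- have [n Hn] : exists n : nat, e k = Z.of_nat n by exists (Z.to_nat (e k)); lia.
  have Hpow : forall w, Czpow w (e k) = (w ^ n)%C.
    by move=> w; rewrite Hn; case: n {Hn} => [|n] //=; rewrite SuccNat2Pos.id_succ.
  have addk : forall e e' : nat -> Z, (e k + e' k = e k + e' k)%Z by [].
  (* Division of [z_k^n] by [z_k - mid]: the quotient is polynomial in [z_k], so it has no term in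
     [1 / z_k]. *)
  have [Q [HQ HQe]] : exists Q, filt d (fun e => e k) T 0 Q /\
      forall z, (z k ^ n = (z k - mid z) * Q z + mid z ^ n)%C.
    elim: n {Hn Hpow} => [|n [Q [HQ IH]]].
      exists (fun _ => RtoC 0); split; first exact: filt_const.
      by move=> z /=; ring.
    exists (fun z => z k * Q z + mid z ^ n)%C; split.
      apply: filt_plus => //.
        apply: (filt_mult _ _ _ _ _ 1 0) => //.
        by apply: filt_coord; [lia | solve_delta].
      by apply: filt_pow_0 => //; apply: filt_mid => //; solve_delta.
    move=> z; rewrite !Cpow_S IH; ring.
  (* The remainder [mid^n] meets [1 / (z_k - mid) - 1 / z_k = mid / (z_k (z_k - mid))], which is of
     order [z_k^(-2)]. *)
  apply: (torus_int_eq_0_ext d eps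
    (fun z => 1 * (Rk z * (mon d e' z * Q z)) +
       Rk z * (mon d e' z * (mid z ^ (S n) * (/ z k * / (z k - mid z)))))%C) => //.
    move=> z Hz; rewrite /Phi monE monE' !Hpow HQe Cpow_S.
    have H1 := Hznz z Hz. have H2 := z_neq_mid z Hz.
    by field.
  apply: torus_int_plus_0 => //.
    apply: (filt_torus_int_0 d eps (fun e => e k) 0) => //.
      by move=> e1 ->; lia.
    apply: (filt_mult _ _ _ _ _ 0 0) => //.
      by apply: filt_Cprod_coord_inv => //; [lia | move=> l Hl; solve_delta].
    apply: (filt_mult _ _ _ _ _ 0 0) => //.
    by apply: approx_mon; rewrite He'k.
  have addk' : forall e e' : nat -> Z, (- (e k + e' k) = - e k + - e' k)%Z by move=> *; lia.
  apply: (filt_torus_int_0 d eps (fun e => - e k)%Z 2) => //.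
    by move=> e1 ->; lia.
  apply: (filt_mult _ _ _ _ _ 0 2) => //.
    by apply: filt_Cprod_coord_inv => //; [lia | move=> l Hl; solve_delta].
  apply: (filt_mult _ _ _ _ _ 0 2) => //.
    by apply: approx_mon; rewrite He'k.
  apply: (filt_mult _ _ _ _ _ 0 2) => //.
    by apply: filt_pow_0 => //; apply: filt_mid => //; solve_delta.
  apply: (filt_mult _ _ _ _ _ 1 1) => //.
    by apply: filt_coord_inv; [lia | solve_delta].
  by apply: filt_inv_z_minus_mid => //; solve_delta.
- have [p Hp] : exists p, e k = Z.neg p by case: (e k) Hek => [|p|p]; try lia; exists p.
  have [P1 P2] := mid_coefs_pos.
  apply: (torus_int_eq_0_ext d eps
    (fun z => RtoC (-1) * (Rk z * (mon d e' z * ((/ mid z) ^ Pos.to_nat p * / z k)))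
      + Rk z * (mon d e z * / (z k - mid z)))%C) => //.
    move=> z Hz; rewrite /Phi monE' Hp /=.
    have Hm : mid z <> 0.
      move=> E.
      have : Cmod (RtoC (INR k / INR (S k)) * z (S k))%C
        = Cmod (- (RtoC (/ INR (S k)) * z 0%nat))%C.
        by congr Cmod; rewrite -[RHS]Cplus_0_r -E /mid; ring.
      rewrite Cmod_opp !Cmod_mult !Cmod_R !Rabs_pos_eq; try lra.
      rewrite !Hz; try lia.
      move=> E2; have := f_equal (Rmult (INR (S k))) E2.
      have H1 := INR_Sk_pos.
      replace (INR (S k) * (/ INR (S k) * eps 0%nat)) with (eps 0%nat) by (field; lra).
      replace (INR (S k) * (INR k / INR (S k) * eps (S k)))
        with (INR k * eps (S k)) by (field; lra).
      lra.
    rewrite Cpow_inv //; ring.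
  apply: torus_int_plus_0 => //.
    have add0 : forall e e' : nat -> Z, (e 0%nat + e' 0%nat = e 0%nat + e' 0%nat)%Z by [].
    apply: (filt_torus_int_0 d eps (fun e => e 0%nat)%Z 0) => //.
      by move=> e1 ->; lia.
    apply: (filt_mult _ _ _ _ _ 0 0) => //.
      by apply: filt_Cprod_coord_inv => //; [lia | move=> l Hl; solve_delta].
    apply: (filt_mult _ _ _ _ _ 0 0) => //.
      by apply: approx_mon; rewrite He'0; lia.
    apply: (filt_mult _ _ _ _ _ 0 0) => //; last first.
      by apply: filt_coord_inv; [lia | solve_delta].
    apply: filt_pow_0 => //.
    (* Since [z_{k+1}] dominates, [1 / mid] expands in nonnegative powers of [z_0]. *)
    apply: (filt_ext _ _ _ _ (fun z => / (RtoC (INR k / INR (S k)) * z (S k) -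
       (RtoC (- / INR (S k)) * z 0%nat + RtoC 0 * z 0%nat)))%C).
      by move=> z _; congr Cinv; rewrite /mid RtoC_opp; ring.
    apply: (filt_sub _ _ _ _ _ _ box_torus).
    apply: filt_inv_linear => //; try lia; try solve_delta.
    rewrite Rabs_Ropp Rabs_R0 Rabs_pos_eq; last lra.
    have H1 := INR_Sk_pos.
    apply: (Rmult_lt_reg_l (INR (S k))) => //.
    replace (INR (S k) * (/ INR (S k) * eps 0%nat + 0 * eps 0%nat))
      with (eps 0%nat) by (field; lra).
    by replace (INR (S k) * (INR k / INR (S k) * eps (S k)))
      with (INR k * eps (S k)) by (field; lra).
  have addk' : forall e e' : nat -> Z, (- (e k + e' k) = - e k + - e' k)%Z by move=> *; lia.
  apply: (filt_torus_int_0 d eps (fun e => - e k)%Z 2) => //.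
    by move=> e1 ->; lia.
  apply: (filt_mult _ _ _ _ _ 0 2) => //.
    by apply: filt_Cprod_coord_inv => //; [lia | move=> l Hl; solve_delta].
  apply: (filt_mult _ _ _ _ _ 1 1) => //.
    by apply: approx_mon; lia.
  by apply: filt_inv_z_minus_mid => //; solve_delta.
Qed.

Lemma add_lam0 (e e' : nat -> Z) : lam0 (fun i => e i + e' i)%Z = (lam0 e + lam0 e')%Z.
Proof. by []. Qed.

(** Passage from monomials to limits. As [g] is also evaluated at [z_k = mid], off the torus, the
    approximation must be uniform on a region [X] containing those points as well. *)
Lemma torus_int_step (X : (nat -> C) -> Prop) (g : (nat -> C) -> C) :
  (forall z, T z -> X z) -> (forall z, T z -> X (upd z k (mid z))) ->
  filt d (fun e => e 0%nat + e k)%Z X (-1) g ->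
  filt d lam0 T 0 (Phi g) /\ torus_int eps d (Phi g) = 0.
Proof.
move=> HX HX' Hg; have annT := annular_torus d eps eps_pos.
have HR0 : filt d lam0 T 0 Rk by apply: filt_Cprod_coord_inv => //; lia.
have HA : filt d lam0 T 0 (fun z => Rk z * / (z k - mid z))%C.
  apply: (filt_mult _ _ _ add_lam0 annT 0 0) => //.
  by apply: filt_inv_z_minus_mid.
have HB : filt d lam0 T 0 (fun z => Rk z * / z k)%C.
  apply: (filt_mult _ _ _ add_lam0 annT 0 0) => //.
  by apply: filt_coord_inv => //; lia.
have [MA [HMA HA']] := approx_bounded d _ T _ annT HA.
have [MB [HMB HB']] := approx_bounded d _ T _ annT HB.
apply: torus_int_lim_0 => // r Hr.
have Hr' : 0 < r / (MA + MB + 1) by apply: Rdiv_lt_0_compat; lra.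
have [P [HP HgP]] := Hg _ Hr'.
exists (Phi P).
have [H1 H2] : filt d lam0 T 0 (Phi P) /\ torus_int eps d (Phi P) = 0.
  elim: {HgP} HP => [|c e Q He HQ IH].
    apply: (torus_int_eq_0_ext d eps (fun _ => RtoC 0)) => //.
      by move=> z _; rewrite /Phi; ring.
    apply: (filt_torus_int_0 d eps (fun _ => 0)%Z 1) => //.
    by apply: approx_laurent; constructor.
  apply: (torus_int_eq_0_ext d eps (fun z => c * Phi (mon d e) z + Phi Q z)%C) => //.
    by move=> z _; rewrite /Phi; ring.
  by apply: torus_int_plus_0 => //; apply: Phi_mon.
split=> //; split=> // z Hz.
replace (Phi g z - Phi P z)%C with
  ((Rk z * / (z k - mid z)) * (g z - P z) +
   - ((Rk z * / z k) * (g (upd z k (mid z)) - P (upd z k (mid z)))))%C by (rewrite /Phi; ring).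
apply: (Rle_trans _ _ _ (Cmod_triangle _ _)).
rewrite Cmod_opp (Cmod_mult (_ * _)%C (g z - _)%C) (Cmod_mult (Rk z * / z k)%C).
have K1 := HgP z (HX z Hz). have K2 := HgP _ (HX' z Hz).
have K3 := HA' z Hz. have K4 := HB' z Hz.
have L1 := Rmult_le_compat _ _ _ _ (Cmod_ge_0 _) (Cmod_ge_0 _) K3 K1.
have L2 := Rmult_le_compat _ _ _ _ (Cmod_ge_0 _) (Cmod_ge_0 _) K4 K2.
have : r = (MA + MB + 1) * (r / (MA + MB + 1)) by field; lra.
nra.
Qed.

End Step.

(** * Reduction to arithmetic progressions *)

(** [e_poly] without its extreme factors [N y] (for [r = 0]) and [N x] (for [r = N]), which take
    part in the cancellations. *)
Definition ehat (N : nat) (x y : C) : C :=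
  Cprod (fun r => RtoC (INR r) * x + RtoC (INR (N - r)) * y)%C 1 (N - 1).

(** The exponents for [a = N - 2 - j] and [b = -1]: [z_0] gets [-N + a + 1], the 1 coming from [e];
    each [z_l] with [l >= 1] keeps [-(N - 1)], which makes its quotient with [ehat] homogeneous of
    degree 0; the last factor is the effect of [b]. *)
Definition numer (N d j : nat) (w : nat -> C) : C :=
  ((/ w 0%nat) ^ S j * (w 1%nat - w 0%nat) ^ j
   * Cprod (fun l => ehat N (w (l - 1)%nat) (w l) * (/ w l) ^ (N - 1)) 1 d * / w d)%C.

(** The second difference, zero exactly when the three points are in progression; the factors
    [RtoC 1] match the shape of [filt_inv_linear]. *)
Definition defect (l : nat) (w : nat -> C) : C :=
  (RtoC 2 * w l - (RtoC 1 * w (l - 1)%nat + RtoC 1 * w (l + 1)%nat))%C.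

(* [z_1, ..., z_{k-1}] moved to arithmetic progression between [z_0] and [z_k]; the subtraction
   and the zero term put it in the shape [alpha z_i - (b1 z_p + b2 z_q)] of [filt_inv_linear]. *)
Definition arith (k : nat) (z : nat -> C) (i : nat) : C :=
  if (i <? k)%nat
  then (RtoC (INR i / INR k) * z k
        - (RtoC (- (INR (k - i) / INR k)) * z 0%nat + RtoC 0 * z 0%nat))%C
  else z i.

(* [stage 1] is the integrand, up to a power of [N]; [stage k] is what remains once the factors
   [/ defect l], [l < k], have been used to eliminate [z_1, ..., z_{k-1}].  The dummy factors
   [/ z_l] keep the number of integrations equal to [d + 1]. *)
Definition stage (N d j k : nat) (z : nat -> C) : C :=
  (numer N d j (arith k z) * (Cprod (fun l => / z l) 1 (k - 1) * RtoC (/ INR k))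
   * Cprod (fun l => / defect l (arith k z)) k (d - 1))%C.

Lemma arith_ge (k i : nat) z : (k <= i)%nat -> arith k z i = z i.
Proof. by rewrite /arith; case: Nat.ltb_spec => //; lia. Qed.

Lemma arith_0 (k : nat) z : (1 <= k)%nat -> arith k z 0 = z 0%nat.
Proof.
move=> Hk; rewrite /arith; case: Nat.ltb_spec; last lia.
move=> _; have H : 0 < INR k by apply: lt_0_INR; lia.
rewrite Nat.sub_0_r; replace (INR k / INR k) with 1 by (field; lra).
replace (INR 0 / INR k) with 0 by (rewrite /=; field; lra).
rewrite RtoC_opp; ring.
Qed.

Lemma arith_1 z : arith 1 z = z.
Proof.
apply: functional_extensionality => i; case: i => [|i]; first exact: arith_0.
by apply: arith_ge; lia.
Qed.

(** [mid] lies at [k / (k + 1)] of the way from [z_0] to [z_{k+1}], so cutting the segment up to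
    [mid] into [k] parts gives the first [k] of [k + 1] equal parts. *)
Lemma arith_S (k : nat) z : (1 <= k)%nat -> arith (S k) z = arith k (upd z k (mid k z)).
Proof.
move=> Hk; apply: functional_extensionality => i.
have H : 0 < INR k by apply: lt_0_INR; lia.
have H' : 0 < INR (S k) by apply: lt_0_INR; lia.
have upk : forall w, upd z k w k = w by move=> w; rewrite /upd Nat.eqb_refl.
have up : forall w l, l <> k -> upd z k w l = z l.
  by move=> w l Hl; rewrite /upd; case: Nat.eqb_spec.
case: (lt_eq_lt_dec i k) => [[Hi|Hi]|Hi].
- rewrite /arith; case: Nat.ltb_spec; last lia. case: Nat.ltb_spec; last lia.
  move=> _ _; rewrite upk up; last lia.
  rewrite /mid !minus_INR; try lia.
  have HC : RtoC (INR k) <> 0 by move/RtoC_inj; lra.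
  have HC' : RtoC (INR (S k)) <> 0 by move/RtoC_inj; lra.
  have HC1 : RtoC (INR k + 1) <> 0 by rewrite -S_INR.
  rewrite /Rdiv !RtoC_opp !RtoC_mult !RtoC_inv ?RtoC_minus; try lra.
  rewrite !S_INR !RtoC_plus.
  rewrite RtoC_plus in HC1.
  field; split=> //.
- rewrite Hi (arith_ge k) // upk /arith; case: Nat.ltb_spec; last lia.
  move=> _; rewrite /mid.
  have -> : (S k - k = 1)%nat by lia.
  rewrite RtoC_opp /Rdiv /= Rmult_1_l; ring.
- by rewrite !arith_ge ?up //; lia.
Qed.

(** The point is [(i z_k + (k - i) z_0) / k]; the bound with [k - 1] is domination by [z_k] in the
    worst case [i = 1]. *)
Lemma filt_inv_arith (d k i : nat) lam (lo hi : nat -> R) (c : Z) :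
  (forall e e', lam (fun i => e i + e' i)%Z = (lam e + lam e')%Z) ->
  (forall i, (i <= d)%nat -> 0 < lo i) ->
  (1 <= i <= k)%nat -> (k <= d)%nat -> 0 <= hi 0%nat ->
  (INR k - 1) * hi 0%nat < lo k ->
  (c <= lam (delta k (-1)))%Z -> (0 <= lam (delta 0 1) + lam (delta k (-1)))%Z ->
  filt d lam (box d lo hi) c (fun z => / arith k z i)%C.
Proof.
move=> Hadd Hlo Hik Hkd Hhi Hdom Hc Hl.
have Hkp : 0 < INR k by apply: lt_0_INR; lia.
have Hip : 1 <= INR i by have := le_INR 1 i ltac:(lia).
have Hik' : INR i <= INR k by apply: le_INR; lia.
case: (Nat.eq_dec i k) => E.
  have -> : (fun z => / arith k z i)%C = (fun z => / z k)%C.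
    by apply: functional_extensionality => z; rewrite E arith_ge.
  apply: filt_coord_inv => //.
have -> : (fun z => / arith k z i)%C = (fun z => / (RtoC (INR i / INR k) * z k -
   (RtoC (- (INR (k - i) / INR k)) * z 0%nat + RtoC 0 * z 0%nat)))%C.
  by apply: functional_extensionality => z; rewrite /arith; case: Nat.ltb_spec => //; lia.
apply: filt_inv_linear => //; try lia.
  by apply: Rdiv_lt_0_compat; lra.
rewrite Rabs_Ropp Rabs_R0 minus_INR ?Rabs_pos_eq; [| |lia]; last first.
  apply: Rmult_le_pos; first lra. by left; apply: Rinv_0_lt_compat.
apply: (Rmult_lt_reg_l (INR k)) => //.
have Hk0 : 0 < lo k by apply: Hlo.
move: (lo k) (hi 0%nat) Hk0 Hdom Hhi => kap e0 Hk0 Hdom Hhi.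
replace (INR k * ((INR k - INR i) / INR k * e0 + 0 * e0)) with
  ((INR k - INR i) * e0) by (field; lra).
replace (INR k * (INR i / INR k * kap)) with (INR i * kap) by (field; lra).
have L1 : 0 <= (INR i - 1) * kap by apply: Rmult_le_pos; lra.
have L2 : 0 <= (INR i - 1) * e0 by apply: Rmult_le_pos; lra.
lra.
Qed.

Section FiltNumer.

Variables (N d j k : nat) (a : Z) (lam : (nat -> Z) -> Z) (X : (nat -> C) -> Prop).
Variable w : (nat -> C) -> nat -> C.
Hypothesis lam_add : forall e e', lam (fun i => e i + e' i)%Z = (lam e + lam e')%Z.
Hypothesis annX : annular d X.
Hypothesis Hk : (1 <= k)%nat.
Hypothesis low : forall i, (i <= k)%nat ->
  filt d lam X a (fun z => w z i) /\ filt d lam X (- a) (fun z => / w z i)%C.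
Hypothesis high : forall i, (k < i <= d)%nat ->
  filt d lam X 0 (fun z => w z i) /\ filt d lam X 0 (fun z => / w z i)%C.
Hypothesis inv_last : filt d lam X 0 (fun z => / w z d)%C.
Hypothesis a_pos : (0 <= a)%Z.

Lemma filt_ehat b (x y : (nat -> C) -> C) :
  filt d lam X b x -> filt d lam X b y ->
  filt d lam X (Z.of_nat (N - 1) * b) (fun z => ehat N (x z) (y z)).
Proof.
move=> Hx Hy.
have := filt_Cprod d lam X lam_add annX b 1 (N - 1)
  (fun r z => RtoC (INR r) * x z + RtoC (INR (N - r)) * y z)%C.
have -> : (S (N - 1) - 1 = N - 1)%nat by lia.
apply=> l _; apply: filt_plus; exact: filt_scal.
Qed.

(** Weights: [-(j + 1) a + j a = - a] from the first two factors; in [ehat / w_l^(N - 1)] they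
    cancel for [l <= k] and are nonnegative for [l > k]. It serves with [a = 1] for the joint degree
    and with [a = 0] for mere approximability. *)
Lemma filt_numer : filt d lam X (- a) (fun z => numer N d j (w z)).
Proof.
have [H0 H0'] := low 0%nat ltac:(lia).
have [H1 _] := low 1%nat Hk.
apply: (filt_mult _ _ _ lam_add annX (- a) 0) => //; first lia.
apply: (filt_mult _ _ _ lam_add annX (- a) 0) => //; first lia.
  apply: (filt_mult _ _ _ lam_add annX (Z.of_nat (S j) * - a) (Z.of_nat j * a)) => //; first nia.
    exact: filt_pow.
  by apply: filt_pow => //; apply: filt_minus.
apply: (filt_Cprod_0 _ _ _ lam_add annX _ _
  (fun l z => ehat N (w z (l - 1)%nat) (w z l) * (/ w z l) ^ (N - 1))%C) => l Hl.
case: (le_lt_dec l k) => Hlk.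
  have [K1 K2] := low l Hlk. have [K3 _] := low (l - 1)%nat ltac:(lia).
  apply: (filt_mult _ _ _ lam_add annX (Z.of_nat (N - 1) * a) (Z.of_nat (N - 1) * - a)); first lia.
    exact: filt_ehat.
  exact: filt_pow.
have [K1 K2] := high l ltac:(lia).
have K3 : filt d lam X 0 (fun z => w z (l - 1)%nat).
  case: (le_lt_dec (l - 1) k) => Hlk'.
    by have [K _] := low (l - 1)%nat Hlk'; apply: filt_weaken K.
  by have [K _] := high (l - 1)%nat ltac:(lia).
apply: (filt_mult _ _ _ lam_add annX (Z.of_nat (N - 1) * 0) 0); first lia.
  exact: filt_ehat.
exact: filt_pow_0.
Qed.

End FiltNumer.

(** * Successive elimination of the inner variables *)

Section Reduction.

Variables (N d j : nat) (eps : nat -> R).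
Hypothesis adm : admissible d eps.
Hypothesis eps0_tiny : forall i, (1 <= i <= d)%nat -> INR d * eps 0%nat < eps i.

Let eps_pos : forall i, (i <= d)%nat -> 0 < eps i := proj1 adm.

(** Admissible radii are strictly concave in the index, so the mean of the first [k] increments
    exceeds the next increment. *)
Lemma eps_concave (k : nat) : (1 <= k <= d - 1)%nat ->
  eps 0%nat + INR k * eps (S k) < INR (S k) * eps k.
Proof.
case: k => [|k]; first lia.
elim: k => [|k IH] Hk.
  have := proj2 adm 1%nat ltac:(lia); rewrite /=; lra.
have {}IH := IH ltac:(lia).
have := proj2 adm (S (S k)) ltac:(lia).
replace (S (S k) - 1)%nat with (S k) by lia.
replace (S (S k) + 1)%nat with (S (S (S k))) by lia.
move: IH; rewrite !S_INR; have := pos_INR k; nra.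
Qed.

(** The bound [lo k] is the least possible modulus of [mid], so that the box contains the torus and
    its image under [z_k := mid], as [torus_int_step] requires. *)
Lemma filt_stage_factor (k : nat) (Hk : (1 <= k <= d - 1)%nat) :
  let lo := fun i => if (i =? k)%nat then (INR k * eps (S k) - eps 0%nat) / INR (S k) else eps i in
  filt d (fun e => e 0%nat + e k)%Z (box d lo eps) (-1)
   (fun z => numer N d j (arith k z) * Cprod (fun l => / defect l (arith k z)) (S k) (d - 1))%C.
Proof.
move=> lo.
have Hkp : 0 < INR k by apply: lt_0_INR; lia.
have HSk : 0 < INR (S k) by apply: lt_0_INR; lia.
have Hk1 : 1 <= INR k by have := le_INR 1 k ltac:(lia).
have He0 := eps_pos 0%nat ltac:(lia).
have Hkd : INR k * eps 0%nat < eps (S k).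
  have := eps0_tiny (S k) ltac:(lia).
  have := Rmult_le_compat_r _ _ _ (Rlt_le _ _ He0) (le_INR k d ltac:(lia)); lra.
(* Multiplied by [k + 1], the left side is [(k^2 - 1) eps_0], and [k eps_0 < eps_{k+1}] suffices. *)
have Hkappa : (INR k - 1) * eps 0%nat < (INR k * eps (S k) - eps 0%nat) / INR (S k).
  apply: (Rmult_lt_reg_r (INR (S k))) => //.
  rewrite /Rdiv [X in _ < X]Rmult_assoc Rinv_l; last lra.
  rewrite S_INR; nra.
have Hlo : forall i, (i <= d)%nat -> 0 < lo i.
  move=> i Hi; rewrite /lo; case: Nat.eqb_spec => _; last exact: eps_pos.
  apply: Rle_lt_trans Hkappa; nra.
have ann := annular_box d lo eps Hlo.
set lam := fun e : nat -> Z => (e 0%nat + e k)%Z.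
have lam_add : forall e e', lam (fun i => e i + e' i)%Z = (lam e + lam e')%Z.
  by rewrite /lam => e e'; lia.
have coord : forall i c, (i <= d)%nat -> (c <= lam (delta i 1))%Z ->
    filt d lam (box d lo eps) c (fun z => z i).
  by move=> *; apply: filt_coord.
have big : forall i, (k <= i <= d)%nat ->
    (fun z => arith k z i) = (fun z => z i) /\ (fun z => / arith k z i)%C = (fun z => / z i)%C.
  by move=> i Hi; split; apply: functional_extensionality => z; rewrite arith_ge //; lia.
apply: (filt_mult _ _ _ lam_add ann (-1) 0) => //.
- apply: (filt_numer N d j k 1 lam _ (fun z => arith k z)) => //; first lia.
  + move=> i Hi; case: (Nat.eq_dec i k) => Hik.
      have [-> ->] := big i ltac:(lia); split.
        apply: coord; [lia | rewrite /lam; solve_delta].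
      apply: filt_coord_inv; [lia | rewrite /lam; solve_delta].
    have arE : forall z, arith k z i = (RtoC (INR i / INR k) * z k -
       (RtoC (- (INR (k - i) / INR k)) * z 0%nat + RtoC 0 * z 0%nat))%C.
      by move=> z; rewrite /arith; case: Nat.ltb_spec => //; lia.
    have -> : (fun z => arith k z i) = (fun z => RtoC (INR i / INR k) * z k -
       (RtoC (- (INR (k - i) / INR k)) * z 0%nat + RtoC 0 * z 0%nat))%C.
      by apply: functional_extensionality => z; rewrite arE.
    split.
      apply: filt_minus; last apply: filt_plus; apply: filt_scal => //; apply: coord; try lia;
        rewrite /lam; solve_delta.
    case: (Nat.eq_dec i 0) => Hi0.
      rewrite Hi0.
      apply: (filt_ext _ _ _ _ (fun z => / z 0%nat)%C).
        by move=> z _; rewrite arith_0 //; lia.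
      apply: filt_coord_inv; [lia | rewrite /lam; solve_delta].
    apply: filt_inv_arith => //; try lia; try (rewrite /lam; solve_delta); first lra.
    by rewrite /lo Nat.eqb_refl.
  + move=> i Hi.
    have [-> ->] := big i ltac:(lia); split.
      apply: coord; [lia | rewrite /lam; solve_delta].
    apply: filt_coord_inv; [lia | rewrite /lam; solve_delta].
  + have [_ ->] := big d ltac:(lia).
    apply: filt_coord_inv; [lia | rewrite /lam; solve_delta].
- apply: (filt_Cprod_0 _ _ _ lam_add ann _ _ (fun l z => / defect l (arith k z))%C) => l Hl.
  apply: (filt_ext _ _ _ _ (fun z => / defect l z)%C).
    by move=> z _; rewrite /defect !arith_ge //; lia.
  apply: filt_inv_linear => //; try lia; try (rewrite /lam; solve_delta); first lra.
  rewrite Rabs_R1 /lo; case: Nat.eqb_spec; first lia.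
  have := proj2 adm l ltac:(lia); lra.
Qed.

Lemma torus_int_stage_S (k : nat) : (1 <= k <= d - 1)%nat ->
  torus_int eps d (stage N d j (S k)) = torus_int eps d (stage N d j k).
Proof.
move=> Hk.
have Hkp : 0 < INR k by apply: lt_0_INR; lia.
have HSk : 0 < INR (S k) by apply: lt_0_INR; lia.
have Hk1 : 1 <= INR k by have := le_INR 1 k ltac:(lia).
have He0 := eps_pos 0%nat ltac:(lia).
have Hsmall : eps 0%nat < INR k * eps (S k).
  have K1 := eps0_tiny (S k) ltac:(lia).
  have K2 : 1 <= INR d by have := le_INR 1 d ltac:(lia).
  have K3 : 0 <= (INR d - 1) * eps 0%nat by apply: Rmult_le_pos; lra.
  have K4 : 0 <= (INR k - 1) * eps (S k).
    by apply: Rmult_le_pos; [lra | left; apply: eps_pos; lia].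
  lra.
have Hconc := eps_concave k Hk.
have ann := annular_torus d eps eps_pos.
set g := fun z =>
  (numer N d j (arith k z) * Cprod (fun l => / defect l (arith k z)) (S k) (d - 1))%C.
have Hg := filt_stage_factor k Hk; cbv zeta in Hg.
set X := box _ _ _ in Hg.
have Hdist : (INR k * eps (S k) - eps 0%nat) / INR (S k) <= eps k.
  apply: (Rmult_le_reg_r (INR (S k))) => //.
  rewrite /Rdiv Rmult_assoc Rinv_l; lra.
have HTX : forall z, torus d eps z -> X z.
  move=> z Hz; apply: torus_box Hz => i Hi; case: Nat.eqb_spec => [->|_]; lra.
have HTX' : forall z, torus d eps z -> X (upd z k (mid k z)).
  move=> z Hz i Hi; rewrite /upd; case: Nat.eqb_spec => [->|_]; last by rewrite Hz //; lra.
  have [P1 P2] := mid_coefs_pos d k Hk.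
  have M1 : Cmod (RtoC (/ INR (S k)) * z 0%nat)%C = / INR (S k) * eps 0%nat.
    by rewrite Cmod_mult Cmod_R Rabs_pos_eq ?Hz //; [lia | lra].
  have M2 : Cmod (RtoC (INR k / INR (S k)) * z (S k))%C = INR k / INR (S k) * eps (S k).
    by rewrite Cmod_mult Cmod_R Rabs_pos_eq ?Hz //; [lia | lra].
  split.
    have := Cmod_triangle (mid k z) (- (RtoC (/ INR (S k)) * z 0%nat))%C.
    have -> : (mid k z + - (RtoC (/ INR (S k)) * z 0%nat))%C
        = (RtoC (INR k / INR (S k)) * z (S k))%C.
      by rewrite /mid; ring.
    rewrite Cmod_opp M1 M2.
    replace ((INR k * eps (S k) - eps 0%nat) / INR (S k)) with
      (INR k / INR (S k) * eps (S k) - / INR (S k) * eps 0%nat) by (field; lra).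
    lra.
  apply: (Rle_trans _ _ _ (Cmod_triangle _ _)); rewrite M1 M2.
  have := mid_dominated d k eps Hk Hconc; lra.
set Phi := fun z => (Cprod (fun l => / z l) 1 (k - 1) *
  (g z * / (z k - mid k z) - g (upd z k (mid k z)) * / z k))%C.
have [H1 H2] : filt d lam0 (torus d eps) 0 Phi /\ torus_int eps d Phi = 0.
  exact: torus_int_step HTX HTX' Hg.
have stE : forall z, torus d eps z -> stage N d j k z =
   (Cprod (fun l => / z l) 1 (k - 1) * RtoC (/ INR (S k)) * (g z * / (z k - mid k z)))%C.
    move=> z Hz; rewrite /stage /g (Cprod_recl _ k); last lia.
  have Hne := z_neq_mid d k eps Hk Hconc z Hz.
  have HC : RtoC (INR k) <> 0 by move/RtoC_inj; lra.
  have HC' : RtoC (INR (S k)) <> 0 by move/RtoC_inj; lra.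
  (* The residue of [1 / defect] in [z_k] is thus [k / (k + 1)]; these factors telescope to the
     [1 / k] of [stage]. *)
  have -> : defect k (arith k z) = (RtoC (INR (S k)) / RtoC (INR k) * (z k - mid k z))%C.
    rewrite /defect (arith_ge k k) // (arith_ge k (k + 1)); last lia.
    rewrite /arith; case: Nat.ltb_spec; last lia. move=> _.
    rewrite /mid; have -> : (k - (k - 1) = 1)%nat by lia.
    have -> : (k + 1 = S k)%nat by lia.
    rewrite minus_INR; last lia.
    rewrite /Rdiv !RtoC_opp !RtoC_mult !RtoC_inv; try lra.
    rewrite RtoC_minus /= -/(INR (S k)).
    have E1 : RtoC (INR (S k)) = (RtoC (INR k) + 1)%C by rewrite S_INR RtoC_plus.
    rewrite !E1 in HC' *.
    by field.
  rewrite !RtoC_inv; try lra.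
  by field.
have stF : filt d lam0 (torus d eps) 0 (stage N d j k).
  apply: (filt_ext _ _ _ _ _ _ (fun z Hz => eq_sym (stE z Hz))).
  apply: (filt_mult _ _ _ _ ann 0 0) => //.
    apply: (filt_mult _ _ _ _ ann 0 0) => //; last exact: filt_const.
    by apply: filt_Cprod_coord_inv => //; lia.
  apply: (filt_mult _ _ _ _ ann 0 0) => //.
    by apply: (filt_sub _ _ X) => //; apply: filt_lam0 Hg.
  exact: filt_inv_z_minus_mid.
(* [stage (k + 1)] and [stage k] are the two halves of [Phi], both divided by [k + 1]. *)
transitivity (torus_int eps d (fun z => - RtoC (/ INR (S k)) * Phi z + stage N d j k z)%C);
  last first.
  by rewrite (torus_int_lincomb d eps eps_pos _ _ _ Phi _ H1 stF) H2; ring.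
apply: torus_int_ext => // z Hz; rewrite stE // /Phi.
rewrite {1}/stage arith_S; last lia.
have -> : Cprod (fun l => / z l)%C 1 (S k - 1) = (Cprod (fun l => / z l) 1 (k - 1) * / z k)%C.
  have -> : (S k - 1 = S (k - 1))%nat by lia.
  by rewrite Cprod_recr; [congr (_ * / z _)%C; lia | lia].
rewrite -/(g (upd z k (mid k z))).
rewrite /g; ring.
Qed.

Lemma torus_int_stage (k : nat) : (1 <= k <= d)%nat ->
  torus_int eps d (stage N d j 1) = torus_int eps d (stage N d j k).
Proof.
case: k => [|k]; first lia.
elim: k => [|k IH] Hk; first reflexivity.
rewrite (torus_int_stage_S (S k)); last lia.
apply: IH; lia.
Qed.

End Reduction.

(** * Taylor coefficients of rational functions *)

(* A real polynomial as a function of a real and of a complex variable *)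
Inductive polyfn : (R -> R) -> (C -> C) -> Prop :=
| poly_const c : polyfn (fun _ => c) (fun _ => RtoC c)
| poly_id : polyfn (fun x => x) (fun z => z)
| poly_plus f F g G : polyfn f F -> polyfn g G ->
    polyfn (fun x => f x + g x) (fun z => F z + G z)%C
| poly_mult f F g G : polyfn f F -> polyfn g G ->
    polyfn (fun x => f x * g x) (fun z => F z * G z)%C.

Lemma poly_div_x p P : polyfn p P -> exists q Q, polyfn q Q /\
  (forall x, p x = p 0 + x * q x) /\ (forall z, P z = RtoC (p 0) + z * Q z)%C.
Proof.
elim=> [c||f F g G Hf [f1 [F1 [K1 [K2 K3]]]] Hg [g1 [G1 [L1 [L2 L3]]]]
  |f F g G Hf [f1 [F1 [K1 [K2 K3]]]] Hg [g1 [G1 [L1 [L2 L3]]]]].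
- exists (fun _ => 0), (fun _ => RtoC 0); split; first exact: poly_const.
  by split=> x; ring.
- exists (fun _ => 1), (fun _ => RtoC 1); split; first exact: poly_const.
  by split=> x; ring.
- exists (fun x => f1 x + g1 x), (fun z => F1 z + G1 z)%C; split; first exact: poly_plus.
  split=> x; first by rewrite K2 L2; ring.
  by rewrite K3 L3 RtoC_plus; ring.
- exists (fun x => f 0 * g1 x + f1 x * g x), (fun z => RtoC (f 0) * G1 z + F1 z * G z)%C; split.
    apply: poly_plus; apply: poly_mult => //; exact: poly_const.
  split=> x; first by rewrite K2 L2; ring.
  by rewrite K3 L3 RtoC_mult; ring.
Qed.

Lemma poly_derive p P : polyfn p P -> exists q Q, polyfn q Q /\ forall x, is_derive p x (q x).
Proof.
elim=> [c||f F g G Hf [f1 [F1 [K1 K2]]] Hg [g1 [G1 [L1 L2]]]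
  |f F g G Hf [f1 [F1 [K1 K2]]] Hg [g1 [G1 [L1 L2]]]].
- exists (fun _ => 0), (fun _ => RtoC 0); split; first exact: poly_const.
  move=> x; exact: is_derive_const.
- exists (fun _ => 1), (fun _ => RtoC 1); split; first exact: poly_const.
  move=> x; exact: is_derive_id.
- exists (fun x => f1 x + g1 x), (fun z => F1 z + G1 z)%C; split; first exact: poly_plus.
  by move=> x; apply: is_derive_plus.
- exists (fun x => f1 x * g x + f x * g1 x), (fun z => F1 z * G z + F z * G1 z)%C; split.
    by apply: poly_plus; apply: poly_mult.
  move=> x; apply: is_derive_mult => //; exact: Rmult_comm.
Qed.

Lemma poly_continuous p P x : polyfn p P -> continuous p x.
Proof.
move=> /poly_derive [q [Q [_ H]]]; apply: (ex_derive_continuous (V := R_NormedModule)).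
by exists (q x).
Qed.

Lemma poly_neq_0 p P : polyfn p P -> p 0 <> 0 -> locally 0 (fun x => p x <> 0).
Proof.
move=> Hp H0; have Hc := poly_continuous p P 0 Hp.
by apply: (Hc (fun y => y <> 0)); apply: open_neq.
Qed.

Lemma near_imp (x : R) (P Q : R -> Prop) : locally x P -> (forall y, P y -> Q y) -> locally x Q.
Proof. by move=> HP HPQ; apply: (filter_imp P Q). Qed.

Lemma near_and (x : R) (P Q : R -> Prop) : locally x P -> locally x Q ->
  locally x (fun y => P y /\ Q y).
Proof. exact: filter_and. Qed.

Lemma near_forall (x : R) (P : R -> Prop) : (forall y, P y) -> locally x P.
Proof. exact: filter_forall. Qed.

(** Equality near 0 is all that derivatives at 0 see, and it makes the class closed under [Derive]:
    the quotient rule is used only where [q] is nonzero. *)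
Definition rational_near_0 (f : R -> R) : Prop :=
  exists p P q Q, polyfn p P /\ polyfn q Q /\ q 0 <> 0 /\ locally 0 (fun x => f x = p x / q x).

Lemma rational_derive f : rational_near_0 f ->
  rational_near_0 (Derive f) /\ locally 0 (fun x => ex_derive f x).
Proof.
move=> [p [P [q [Q [Hp [Hq [Hq0 Hf]]]]]]].
have [p1 [P1 [Hp1 Dp]]] := poly_derive p P Hp.
have [q1 [Q1 [Hq1 Dq]]] := poly_derive q Q Hq.
have HD : locally 0 (fun x => is_derive f x ((p1 x * q x + -1 * (p x * q1 x)) / (q x * q x))).
  have H := near_and _ _ _ (locally_locally 0 _ Hf) (poly_neq_0 q Q Hq Hq0).
  apply: (near_imp _ _ _ H) => x [Hloc Hqx].
  apply: (is_derive_ext_loc (fun x => p x / q x)).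
    by apply: (near_imp _ _ _ Hloc) => y ->.
  have := is_derive_div p q x (p1 x) (q1 x) (Dp x) (Dq x) Hqx.
  by congr is_derive; rewrite /=; field.
split; last by apply: (near_imp _ _ _ HD) => x Hx; eexists; exact: Hx.
exists (fun x => p1 x * q x + -1 * (p x * q1 x)).
exists (fun x => P1 x * Q x + RtoC (-1) * (P x * Q1 x))%C.
exists (fun x => q x * q x), (fun x => Q x * Q x)%C; split.
  apply: poly_plus; apply: poly_mult => //; [exact: poly_const | exact: poly_mult].
split; first exact: poly_mult.
split; first exact: Rmult_integral_contrapositive.
by apply: (near_imp _ _ _ HD) => x Hx; apply: is_derive_unique.
Qed.

Lemma rational_derive_n f n : rational_near_0 f -> rational_near_0 (Derive_n f n).
Proof. by move=> H; elim: n => [|n IH] //=; apply: proj1 (rational_derive _ IH). Qed.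

Lemma rational_ex_derive_n f n : rational_near_0 f ->
  locally 0 (fun x => forall k, (k <= n)%nat -> ex_derive_n f k x).
Proof.
move=> Hf; elim: n => [|n IH].
  by apply: near_forall => x k Hk; have -> : k = 0%nat by lia.
have [_ H] := rational_derive _ (rational_derive_n f n Hf).
apply: (near_imp _ _ _ (near_and _ _ _ IH H)) => x [H1 H2] k Hk.
case: (Nat.eq_dec k (S n)) => [->|Hn] //; apply: H1; lia.
Qed.

Lemma Derive_n_const_plus_x_mult c f g n : rational_near_0 g ->
  locally 0 (fun x => f x = c + x * g x) ->
  Derive_n f (S n) 0 = INR (S n) * Derive_n g n 0.
Proof.
move=> Hg Hf.
(* Leibniz rule for [x g], proved near 0 and not only at 0 because the induction differentiates
   it. *)
suff H : locally 0 (fun x =>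
    Derive_n f (S n) x = x * Derive_n g (S n) x + INR (S n) * Derive_n g n x).
  by have := locally_singleton _ _ H; rewrite Rmult_0_l Rplus_0_l.
elim: n => [|n IH].
  have [_ Dg] := rational_derive g Hg.
  have H := near_and _ _ _ (locally_locally 0 _ Hf) Dg.
  apply: (near_imp _ _ _ H) => x [Hloc Hd].
  rewrite /= (Derive_ext_loc f (fun y => c + y * g y)) //.
  apply: is_derive_unique; auto_derive => //; ring.
have [_ D1] := rational_derive _ (rational_derive_n g n Hg).
have [_ D2] := rational_derive _ (rational_derive_n g (S n) Hg).
have H := near_and _ _ _ (locally_locally 0 _ IH) (near_and _ _ _ D1 D2).
apply: (near_imp _ _ _ H) => x [Hloc [Hd1 Hd2]].
change (Derive_n f (S (S n)) x) with (Derive (Derive_n f (S n)) x).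
rewrite (Derive_ext_loc _ _ _ Hloc).
apply: is_derive_unique.
change (Derive_n g (S (S n)) x) with (Derive (Derive_n g (S n)) x).
set u := Derive_n g (S n) in Hd2 *. set v := Derive_n g n in Hd1 *.
rewrite (S_INR (S n)); move: (INR (S n)) => c'.
auto_derive => //.
change (Derive (fun y => v y) x) with (u x); change (Derive (fun y => u y) x) with (Derive u x).
ring.
Qed.

Fixpoint taylor_sum (t : nat -> R) (n : nat) (z : C) : C :=
  match n with
  | O => RtoC 0
  | S n' => (taylor_sum t n' z + RtoC (t n') * z ^ n')%C
  end.

Lemma taylor_sum_S t n z :
  taylor_sum t (S n) z = (RtoC (t 0%nat) + z * taylor_sum (fun k => t (S k)) n z)%C.
Proof.
elim: n => [|n IH]; first by rewrite /=; ring.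
change (taylor_sum t (S (S n)) z) with (taylor_sum t (S n) z + RtoC (t (S n)) * z ^ S n)%C.
rewrite IH Cpow_S /=; ring.
Qed.

Definition taylor_coef (f : R -> R) (k : nat) : R := / INR (fact k) * Derive_n f k 0.

(** Division in ascending powers: subtract the constant term of the quotient, divide by the
    variable, repeat. It turns real derivatives into an algebraic identity over C, without complex
    differentiation. *)
Lemma taylor_quotient n p P q Q : polyfn p P -> polyfn q Q -> q 0 <> 0 ->
  exists b B, polyfn b B /\ forall z,
    P z = (taylor_sum (taylor_coef (fun x => p x / q x)%R) n z * Q z + z ^ n * B z)%C.
Proof.
move=> Hp Hq Hq0; elim: n p P Hp => [|n IH] p P Hp.
  by exists p, P; split=> // z /=; ring.
set t0 := p 0 / q 0.
have Hr : polyfn (fun x => p x + - t0 * q x) (fun z => P z + RtoC (- t0) * Q z)%C.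
  by apply: poly_plus => //; apply: poly_mult => //; exact: poly_const.
have [p1 [P1 [Hp1 [E1 E2]]]] := poly_div_x _ _ Hr.
have r0 : p 0 + - t0 * q 0 = 0 by rewrite /t0; field.
rewrite r0 in E1 E2.
have [b [B [Hb HB]]] := IH p1 P1 Hp1.
have Hrat : rational_near_0 (fun x => p1 x / q x).
  by exists p1, P1, q, Q; do 3 split=> //; apply: near_forall.
have HD : forall k, taylor_coef (fun x => p x / q x) (S k) = taylor_coef (fun x => p1 x / q x) k.
  move=> k; rewrite /taylor_coef (Derive_n_const_plus_x_mult t0 _ (fun x => p1 x / q x)) //.
    have H1 := INR_fact_neq_0 k. have H2 : INR (S k) <> 0 by apply: not_0_INR.
    rewrite fact_simpl mult_INR; field; by split.
  apply: (near_imp _ _ _ (poly_neq_0 q Q Hq Hq0)) => x Hx.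
  have := E1 x => E.
  have -> : p x = t0 * q x + x * p1 x by lra.
  by field.
exists b, B; split=> // z.
rewrite taylor_sum_S.
have -> : (fun k => taylor_coef (fun x => p x / q x) (S k)) = taylor_coef (fun x => p1 x / q x).
  exact: functional_extensionality.
have -> : taylor_coef (fun x => p x / q x) 0 = t0 by rewrite /taylor_coef /= /t0; field.
have := E2 z; rewrite HB => E.
have -> : P z = ((P z + RtoC (- t0) * Q z) + RtoC t0 * Q z)%C by rewrite RtoC_opp; ring.
rewrite E Cpow_S; ring.
Qed.

(** For [a = d] this is the combination of two integrals that defines [w_num_h_over_N], up to the
    factor [N]. *)
Lemma taylor_coef_affine_mult (a : R) f k : rational_near_0 f ->
  taylor_coef (fun x => (a + x) * f x) k =
  a * taylor_coef f k + match k with O => 0 | S k' => taylor_coef f k' end.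
Proof.
move=> Hf.
have Hxf : rational_near_0 (fun x => x * f x).
  case: Hf => p [P [q [Q [Hp [Hq [Hq0 H]]]]]].
  exists (fun x => x * p x), (fun z => z * P z)%C, q, Q; split.
    by apply: poly_mult => //; exact: poly_id.
  do 2 split=> //; apply: (near_imp _ _ _ H) => x ->; rewrite /Rdiv; ring.
have Haf : rational_near_0 (fun x => a * f x).
  case: Hf => p [P [q [Q [Hp [Hq [Hq0 H]]]]]].
  exists (fun x => a * p x), (fun z => RtoC a * P z)%C, q, Q; split.
    by apply: poly_mult => //; exact: poly_const.
  do 2 split=> //; apply: (near_imp _ _ _ H) => x ->; rewrite /Rdiv; ring.
rewrite /taylor_coef.
rewrite (Derive_n_ext _ (fun x => a * f x + x * f x)); last by move=> x; ring.
rewrite Derive_n_plus; [|exact: rational_ex_derive_n..].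
rewrite Derive_n_scal_l.
case: k => [|k]; first by rewrite /=; ring.
rewrite (Derive_n_const_plus_x_mult 0 (fun x => x * f x) f) //; last first.
  by apply: near_forall => x; ring.
have H1 := INR_fact_neq_0 k. have H2 : INR (S k) <> 0 by apply: not_0_INR.
rewrite fact_simpl mult_INR; field; by split.
Qed.

Lemma poly_pow p P n : polyfn p P -> polyfn (fun x => p x ^ n) (fun z => P z ^ n)%C.
Proof.
move=> Hp; elim: n => [|n IH]; first exact: poly_const.
exact: poly_mult.
Qed.

(** * Evaluation *)

Lemma Cprod_shift (f : nat -> C) (m n : nat) :
  Cprod (fun k => f (m + k)%nat) 1 n = Cprod f (S m) (m + n).
Proof.
elim: n => [|n IH]; first by rewrite !Cprod_nil //; lia.
rewrite Nat.add_succ_r !Cprod_recr; [|lia|lia].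
by rewrite IH Nat.add_succ_r.
Qed.

Lemma Cprod_rev (f : nat -> C) (n : nat) :
  Cprod (fun k => f (S n - k)%nat) 1 n = Cprod f 1 n.
Proof.
elim: n f => [|n IH] f; first by rewrite !Cprod_nil.
rewrite Cprod_recl; last lia.
have -> : Cprod (fun k => f (S (S n) - k)%nat) 2 (S n) = Cprod (fun k => f (S n - k)%nat) 1 n.
  rewrite -(Cprod_shift (fun k => f (S (S n) - k)%nat) 1 n).
  by apply: Cprod_ext => k Hk.
rewrite IH [RHS]Cprod_recr; last lia.
by rewrite Cmult_comm; congr (_ * f _)%C; lia.
Qed.

(** The [l]-th block of [N] factors will be matched with [e(z_{l-1}, z_l)]. *)
Lemma Cprod_blocks (f : nat -> C) (N d : nat) :
  Cprod f 1 (N * d) = Cprod (fun l => Cprod (fun r => f (N * (l - 1) + r)%nat) 1 N) 1 d.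
Proof.
elim: d => [|d IH]; first by rewrite Nat.mul_0_r !Cprod_nil.
rewrite Cprod_recr; last lia.
rewrite -IH.
have -> : (S d - 1 = d)%nat by lia.
rewrite (Cprod_shift f (N * d) N) Nat.mul_succ_r.
have Chasles := Iter.iter_nat_Chasles _ _ Cmult_1_l Cmult_assoc f 1 (N * d) (N * d + N).
by rewrite {1}/Cprod Chasles //; lia.
Qed.

Lemma Cprod_const (c : C) (n : nat) : Cprod (fun _ => c) 1 n = (c ^ n)%C.
Proof.
elim: n => [|n IH]; first by rewrite Cprod_nil.
by rewrite Cprod_recr ?IH; [rewrite Cpow_S Cmult_comm | lia].
Qed.

(** With this convention the rules for inverses of products and powers hold unconditionally. *)
Lemma Cinv_0 : (/ 0)%C = 0.
Proof. by rewrite /Cinv /RtoC /=; f_equal; rewrite /Rdiv; ring. Qed.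

Lemma Cinv_mult (x y : C) : (/ (x * y) = / x * / y)%C.
Proof.
have [->|Hx] := classic (x = 0); first by rewrite Cinv_0 !Cmult_0_l Cinv_0.
have [->|Hy] := classic (y = 0); first by rewrite Cinv_0 !Cmult_0_r Cinv_0.
by field.
Qed.

Lemma Cinv_1 : (/ 1)%C = 1.
Proof. by rewrite -RtoC_inv ?Rinv_1 //; lra. Qed.

Lemma Cinv_pow (x : C) (n : nat) : (/ x ^ n)%C = ((/ x) ^ n)%C.
Proof. by elim: n => [|n IH]; [exact: Cinv_1 | rewrite !Cpow_S Cinv_mult IH]. Qed.

Lemma Cprod_inv (f : nat -> C) (n : nat) :
  (/ Cprod f 1 n)%C = Cprod (fun k => / f k)%C 1 n.
Proof.
elim: n => [|n IH]; first by rewrite !Cprod_nil // Cinv_1.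
by rewrite !Cprod_recr; [rewrite Cinv_mult IH | lia | lia].
Qed.

Lemma e_poly_ehat (N : nat) (x y : C) : (1 <= N)%nat ->
  e_poly N x y = (RtoC (INR N) * x * (RtoC (INR N) * y) * ehat N x y)%C.
Proof.
case: N => [|n] Hn; first lia.
rewrite /e_poly /ehat Cprod_recl; last lia.
rewrite Cprod_recr; last lia.
rewrite Nat.sub_0_r Nat.sub_diag.
have -> : (S n - 1 = n)%nat by lia.
rewrite -[RtoC (INR 0)]/(RtoC 0); ring.
Qed.

(** Aligns the factors [N z_{l-1}] of [e] with the denominators [N z_l]; only [N z_0] is left
    over. *)
Lemma Cprod_telescope (c : C) (z : nat -> C) (n : nat) :
  Cprod (fun l => c * z (l - 1)%nat)%C 1 (S n) = (c * z 0%nat * Cprod (fun l => c * z l) 1 n)%C.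
Proof.
elim: n => [|n IH]; first by rewrite Cprod_1 Cprod_nil ?Cmult_1_r //; lia.
rewrite Cprod_recr ?IH; [|lia]. rewrite [in RHS]Cprod_recr; last lia.
have -> : (S (S n) - 1 = S n)%nat by lia.
ring.
Qed.

(** The power of [N]: the products [e] give [2 d] factors, and the denominators remove [d - 1]. *)
Lemma w_integrand_stage (N d j : nat) (z : nat -> C) :
  (2 <= N)%nat -> (1 <= d)%nat -> (j <= N - 2)%nat ->
  (forall i, (i <= d)%nat -> z i <> 0) ->
  w_integrand N d j (N - 2 - j) (-1) z = (RtoC (INR N) ^ S d * stage N d j 1 z)%C.
Proof.
move=> HN Hd Hj Hz.
have HNC : RtoC (INR N) <> 0.
  by move/RtoC_inj; apply: not_0_INR; lia.
rewrite /w_integrand /stage arith_1 /numer.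
have -> : Cprod (fun l => / defect l z)%C 1 (d - 1) =
  (Cprod (fun l => RtoC (INR N) * z l) 1 (d - 1) *
   Cprod (fun l => / (RtoC (INR N) * z l * (RtoC 2 * z l - z (l - 1)%nat - z (l + 1)%nat)))
     1 (d - 1))%C.
  rewrite -Cprod_mult; apply: Cprod_ext => l Hl.
  have Hzl := Hz l ltac:(lia).
  rewrite Cinv_mult Cmult_assoc Cinv_r; last exact: Cmult_neq_0.
  by rewrite Cmult_1_l /defect; congr Cinv; ring.
move: (Cprod (fun l => / _)%C 1 (d - 1)) => Den.
rewrite Cprod_recl; last lia.
have E1 :
  (Cprod (fun i => / z i ^ N) 1 d * Cprod (fun l => e_poly N (z (l - 1)%nat) (z l)) 1 d)%C =
  (RtoC (INR N) ^ d * Cprod (fun l => RtoC (INR N) * z (l - 1)%nat) 1 d *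
    Cprod (fun l => ehat N (z (l - 1)%nat) (z l) * (/ z l) ^ (N - 1)) 1 d)%C.
  rewrite -Cprod_const -!Cprod_mult; apply: Cprod_ext => l Hl.
  have Hzl := Hz l ltac:(lia).
  rewrite e_poly_ehat; last lia.
  rewrite Cpow_inv //.
  have -> : N = S (N - 1) by lia.
  rewrite Cpow_S.
  have -> : (S (N - 1) - 1 = N - 1)%nat by lia.
  have Hp := Cpow_nz (z l) (N - 1) Hzl.
  by field.
transitivity ((/ z 0%nat ^ N * (z 0%nat ^ (N - 2 - j) * (z 1%nat - z 0%nat) ^ j)) *
  (Cprod (fun i => / z i ^ N) 1 d * Cprod (fun l => e_poly N (z (l - 1)%nat) (z l)) 1 d) *
  Den * Czpow (z d) (-1))%C; first ring.
rewrite E1 {E1}.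
case: d Hd Hz => [|d] Hd Hz; first lia.
rewrite Cprod_telescope.
have -> : (S d - 1 = d)%nat by lia.
rewrite (Cprod_nil _ 1 (1 - 1)); last lia.
have -> : Czpow (z (S d)) (-1) = (/ z (S d))%C by rewrite /= Cmult_1_r.
have Hz0 := Hz 0%nat ltac:(lia).
rewrite Cpow_inv //.
(* Here [j <= N - 2] enters; the first factor cancels [z_0^a], the last one the [z_0] left by
   [e]. *)
have -> : (z 0%nat ^ N)%C = (z 0%nat ^ (N - 2 - j) * z 0%nat ^ S j * z 0%nat)%C.
  rewrite -Cpow_add_r Cmult_comm -Cpow_S; congr Cpow; lia.
rewrite (Cpow_S (RtoC (INR N)) (S d)).
have H1 := Cpow_nz (z 0%nat) (N - 2 - j) Hz0.
have H2 := Cpow_nz (z 0%nat) (S j) Hz0.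
have H3 := Hz (S d) ltac:(lia).
have -> : RtoC (/ INR 1) = 1 by rewrite /= Rinv_1.
move: (_ ^ (N - 2 - j))%C H1 => A1 H1. move: (_ ^ S j)%C H2 => A2 H2.
by field.
Qed.

(** [r (eps + l - 1) + (N - r) (eps + l) = N (l - 1) + (N - r) + N eps], hence the reversal of the
    product. *)
Lemma ehat_arith (N l : nat) (eps v : C) : (1 <= l)%nat ->
  ehat N ((eps + RtoC (INR (l - 1))) * v)%C ((eps + RtoC (INR l)) * v)%C =
  (v ^ (N - 1) * Cprod (fun r => RtoC (INR (N * (l - 1) + r)) + RtoC (INR N) * eps) 1 (N - 1))%C.
Proof.
move=> Hl; rewrite -[in RHS]Cprod_rev -Cprod_const -Cprod_mult.
apply: Cprod_ext => r Hr.
have -> : (S (N - 1) - r = N - r)%nat by lia.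
rewrite plus_INR mult_INR !minus_INR; try lia.
rewrite RtoC_plus RtoC_mult !RtoC_minus /=; ring.
Qed.

Definition numC (N d : nat) (e : C) : C :=
  Cprod (fun r => RtoC (INR r) + RtoC (INR N) * e)%C 1 (N * d).

Definition denC (N d : nat) (e : C) : C :=
  ((RtoC (INR d) + e) * Cprod (fun r => (RtoC (INR r) + e) ^ N)%C 1 d)%C.

(** Each block lacks its factor [r = N], which is [N (l + e)]: supplying it accounts for [N^(-d)]
    and raises the exponent of [l + e] from [N - 1] to [N]. The further [d + e] in [denC] is
    [1 / w d]. *)
Lemma numer_arith (N d j : nat) (w : nat -> C) (e v : C) : (1 <= N)%nat -> (1 <= d)%nat ->
  v <> 0 -> (forall l, (1 <= l <= d)%nat -> (e + RtoC (INR l))%C <> 0) ->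
  (forall l, (l <= d)%nat -> w l = ((e + RtoC (INR l)) * v)%C) ->
  numer N d j w =
  (/ RtoC (INR N) ^ d * ((/ (e * v)) ^ S j * v ^ j / v * (numC N d e / denC N d e)))%C.
Proof.
move=> HN Hd Hv Hel Hw.
have HNC : RtoC (INR N) <> 0.
  by move/RtoC_inj; apply: not_0_INR; lia.
have w0 : w 0%nat = (e * v)%C by rewrite Hw /=; [ring | lia].
have w1 : w 1%nat = (e * v + v)%C by rewrite Hw /=; [ring | lia].
rewrite /numer w0 w1 (Hw d) //.
have E : Cprod (fun l => ehat N (w (l - 1)%nat) (w l) * (/ w l) ^ (N - 1))%C 1 d =
  (/ RtoC (INR N) ^ d * (numC N d e / Cprod (fun r => (RtoC (INR r) + e) ^ N) 1 d))%C.
  rewrite /numC Cprod_blocks.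
  have HD : Cprod (fun r => (RtoC (INR r) + e) ^ N)%C 1 d <> 0.
    apply: Cprod_neq_0 => l Hl; apply: Cpow_nz; rewrite Cplus_comm; exact: Hel.
  have HNd := Cpow_nz _ d HNC.
  suff K : (Cprod (fun l => ehat N (w (l - 1)%nat) (w l) * (/ w l) ^ (N - 1)) 1 d *
     (RtoC (INR N) ^ d * Cprod (fun r => (RtoC (INR r) + e) ^ N) 1 d))%C =
     Cprod (fun l => Cprod (fun r => RtoC (INR (N * (l - 1) + r)) + RtoC (INR N) * e) 1 N)%C 1 d.
    rewrite -K; by field.
  rewrite -Cprod_const -!Cprod_mult; apply: Cprod_ext => l Hl.
  rewrite !Hw; try lia. rewrite ehat_arith; last lia.
  have He' := Hel l Hl.
  rewrite Cpow_inv; last exact: Cmult_neq_0.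
  rewrite Cpow_mult_l.
  have H1 := Cpow_nz _ (N - 1) Hv. have H2 := Cpow_nz _ (N - 1) He'.
  have EN : N = S (N - 1) by lia.
  rewrite [in RHS]EN [in RHS]Cprod_recr; last lia.
  rewrite -EN.
  have -> : RtoC (INR (N * (l - 1) + N)) = (RtoC (INR N) * RtoC (INR l))%C.
    by rewrite -RtoC_mult -mult_INR; do 2 f_equal; nia.
  have -> : ((RtoC (INR l) + e) ^ N)%C = ((e + RtoC (INR l)) * (e + RtoC (INR l)) ^ (N - 1))%C.
    by rewrite -Cpow_S -EN Cplus_comm.
  move: (Cprod _ 1 (N - 1)) => A.
  by field.
rewrite E /denC.
have He' := Hel d ltac:(lia).
have HD : Cprod (fun r => (RtoC (INR r) + e) ^ N)%C 1 d <> 0.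
  apply: Cprod_neq_0 => l Hl; apply: Cpow_nz; rewrite Cplus_comm; exact: Hel.
have HNd := Cpow_nz _ d HNC.
have He'' : (RtoC (INR d) + e)%C <> 0 by rewrite Cplus_comm.
have -> : (e * v + v - e * v)%C = v by ring.
rewrite [(e + _)%C]Cplus_comm in He' *.
move: ((/ (e * v)) ^ S j)%C => A.
by field.
Qed.

Lemma Rprod_nil (f : nat -> R) (m n : nat) : (n < m)%nat -> Rprod f m n = 1.
Proof. by move=> H; rewrite /Rprod /Iter.iter_nat; replace (S n - m)%nat with 0%nat by lia. Qed.

Lemma Rprod_recr (f : nat -> R) (m n : nat) : (m <= S n)%nat ->
  Rprod f m (S n) = Rprod f m n * f (S n).
Proof.
move=> H; rewrite /Rprod (Iter.iter_nat_Chasles _ _ Rmult_1_l _ f m n) //; try lia.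
  by congr (_ * _); apply: Iter.iter_nat_point; exact: Rmult_1_r.
by move=> x y z; rewrite Rmult_assoc.
Qed.

Lemma poly_prod (f : nat -> R -> R) (F : nat -> C -> C) (n : nat) :
  (forall k, polyfn (f k) (F k)) ->
  polyfn (fun x => Rprod (fun k => f k x) 1 n) (fun z => Cprod (fun k => F k z) 1 n).
Proof.
move=> Hf; elim: n => [|n IH].
  have -> : (fun x => Rprod (fun k => f k x) 1 0) = (fun _ => 1).
    by apply: functional_extensionality => x; rewrite Rprod_nil.
  have -> : (fun z => Cprod (fun k => F k z) 1 0) = (fun _ => RtoC 1).
    by apply: functional_extensionality => x; rewrite Cprod_nil.
  exact: poly_const.
have -> : (fun x => Rprod (fun k => f k x) 1 (S n)) =
    (fun x => Rprod (fun k => f k x) 1 n * f (S n) x).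
  by apply: functional_extensionality => x; rewrite Rprod_recr //; lia.
have -> : (fun z => Cprod (fun k => F k z) 1 (S n)) =
    (fun z => Cprod (fun k => F k z) 1 n * F (S n) z)%C.
  by apply: functional_extensionality => x; rewrite Cprod_recr //; lia.
exact: poly_mult.
Qed.

Definition numR (N d : nat) (x : R) : R := Rprod (fun r => INR r + INR N * x) 1 (N * d).

Definition denR (N d : nat) (x : R) : R :=
  (INR d + x) * Rprod (fun r => (INR r + x) ^ N) 1 d.

Lemma poly_affine (a b : R) : polyfn (fun x => a + b * x) (fun z => RtoC a + RtoC b * z)%C.
Proof.
by apply: poly_plus; [|apply: poly_mult]; [exact: poly_const | exact: poly_const | exact: poly_id].
Qed.

Lemma poly_shift (a : R) : polyfn (fun x => a + x) (fun z => RtoC a + z)%C.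
Proof. apply: poly_plus; [exact: poly_const | exact: poly_id]. Qed.

Lemma poly_num (N d : nat) : polyfn (numR N d) (numC N d).
Proof. by apply: (poly_prod (fun r x => INR r + INR N * x)) => k; exact: poly_affine. Qed.

Lemma poly_den (N d : nat) : polyfn (denR N d) (denC N d).
Proof.
apply: poly_mult; first exact: poly_shift.
by apply: (poly_prod (fun r x => (INR r + x) ^ N)) => k; apply: poly_pow; exact: poly_shift.
Qed.

Lemma denR_0_neq_0 (N d : nat) : (1 <= d)%nat -> denR N d 0 <> 0.
Proof.
move=> Hd; rewrite /denR Rplus_0_r.
apply: Rmult_integral_contrapositive; split; first by apply: not_0_INR; lia.
elim: d {Hd} => [|d IH]; first by rewrite Rprod_nil; [lra | lia].
rewrite Rprod_recr; last lia.
apply: Rmult_integral_contrapositive; split=> //.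
by apply: pow_nonzero; rewrite Rplus_0_r; apply: not_0_INR.
Qed.

Lemma filt_poly (d : nat) lam X p P F :
  (forall e e', lam (fun i => e i + e' i)%Z = (lam e + lam e')%Z) -> annular d X ->
  polyfn p P -> filt d lam X 0 F -> filt d lam X 0 (fun z => P (F z)).
Proof.
move=> Hadd ann Hp HF; elim: Hp => [c||f F1 g G1 _ H1 _ H2|f F1 g G1 _ H1 _ H2] //.
- exact: filt_const.
- exact: filt_plus.
- exact: (filt_mult _ _ _ Hadd ann 0 0).
Qed.

(** * Extraction of the Taylor coefficient from the last stage *)

Section Evaluation.

Variables (N d j : nat) (eps : nat -> R).
Hypothesis HN : (1 <= N)%nat.
Hypothesis Hd : (1 <= d)%nat.
Hypothesis eps_pos : forall i, (i <= d)%nat -> 0 < eps i.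
Hypothesis eps0_tiny : INR d * eps 0%nat < eps d.

Let T := torus d eps.

(* the increment [v] of the progression from [z_0] to [z_d] *)
Definition common_diff (z : nat -> C) : C :=
  (RtoC (/ INR d) * z d - (RtoC (/ INR d) * z 0%nat + RtoC 0 * z 0%nat))%C.

Lemma INR_d_ge_1 : 1 <= INR d.
Proof. exact: (le_INR 1 d Hd). Qed.

Lemma eps0_lt_epsd : eps 0%nat < eps d.
Proof.
have := INR_d_ge_1 => H1; have He0 := eps_pos 0%nat ltac:(lia).
have : 0 <= (INR d - 1) * eps 0%nat by apply: Rmult_le_pos; lra.
lra.
Qed.

Lemma d_common_diff z : (RtoC (INR d) * common_diff z)%C = (z d - z 0%nat)%C.
Proof.
have H := INR_d_ge_1.
have HC : RtoC (INR d) <> 0 by move/RtoC_inj; lra.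
by rewrite /common_diff RtoC_inv; [field | lra].
Qed.

Lemma arith_common_diff z l : (l <= d)%nat ->
  arith d z l = (z 0%nat + RtoC (INR l) * common_diff z)%C.
Proof.
move=> Hl; have H := INR_d_ge_1.
have HC : RtoC (INR d) <> 0 by move/RtoC_inj; lra.
case: (Nat.eq_dec l d) => [->|Hn].
  by rewrite arith_ge // d_common_diff; ring.
rewrite /arith; case: Nat.ltb_spec; last lia. move=> _.
rewrite /common_diff minus_INR //.
rewrite /Rdiv RtoC_opp !RtoC_mult RtoC_inv; last lra.
by rewrite RtoC_minus; field.
Qed.

Lemma common_diff_neq_0 z : T z -> common_diff z <> 0.
Proof.
move=> Hz E; have := d_common_diff z; rewrite E Cmult_0_r => E'.
have Ez : z d = z 0%nat by rewrite -[RHS]Cplus_0_l E'; ring.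
have := eps0_lt_epsd; have <- := Hz d (le_n d); rewrite Ez Hz; lra || lia.
Qed.

Lemma arith_neq_0 z l : T z -> (1 <= l <= d)%nat -> arith d z l <> 0.
Proof.
move=> Hz Hl E.
have H := INR_d_ge_1.
have H1 : 1 <= INR l by apply: (le_INR 1 l); lia.
have H2 : INR l <= INR d by apply: le_INR; lia.
have HC : RtoC (INR d) <> 0 by move/RtoC_inj; lra.
have E2 : (RtoC (INR l) * z d)%C = (- (RtoC (INR d - INR l) * z 0%nat))%C.
  have : (RtoC (INR d) * arith d z l)%C = 0 by rewrite E Cmult_0_r.
  rewrite arith_common_diff; last lia.
  have -> : (RtoC (INR d) * (z 0%nat + RtoC (INR l) * common_diff z))%C =
    (RtoC (INR l) * z d + RtoC (INR d - INR l) * z 0%nat)%C.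
    transitivity (RtoC (INR d) * z 0%nat + RtoC (INR l) * (RtoC (INR d) * common_diff z))%C.
      ring.
    by rewrite d_common_diff RtoC_minus; ring.
  by move=> E3; rewrite -[RHS]Cplus_0_l -E3; ring.
have := f_equal Cmod E2; rewrite Cmod_opp !Cmod_mult !Cmod_R !Rabs_pos_eq; try lra.
rewrite !Hz; try lia.
have He0 := eps_pos 0%nat ltac:(lia).
have Hed := eps_pos d ltac:(lia).
have : 0 <= (INR l - 1) * eps d by apply: Rmult_le_pos; lra.
have : 0 <= INR l * eps 0%nat by apply: Rmult_le_pos; lra.
lra.
Qed.

Let Rd (z : nat -> C) : C := Cprod (fun l => / z l)%C 1 (d - 1).

(* the variable [epsilon] of the right-hand side *)
Let ratio (z : nat -> C) : C := (z 0%nat * / common_diff z)%C.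

Lemma stage_d_eq z : T z -> stage N d j d z =
  (/ RtoC (INR N) ^ d * RtoC (/ INR d) *
   (Rd z * ((/ z 0%nat) ^ S j * common_diff z ^ j / common_diff z *
     (numC N d (ratio z) / denC N d (ratio z)))))%C.
Proof.
move=> Hz; have Hv := common_diff_neq_0 z Hz.
rewrite /stage (Cprod_nil _ d (d - 1)); last lia.
have Hw : forall l, (l <= d)%nat -> arith d z l = ((ratio z + RtoC (INR l)) * common_diff z)%C.
  by move=> l Hl; rewrite arith_common_diff // /ratio; field.
rewrite (numer_arith N d j _ (ratio z) (common_diff z)) //; first last.
- move=> l Hl E; apply: (arith_neq_0 z l Hz Hl).
  by rewrite Hw ?E ?Cmult_0_l //; lia.
- have -> : (ratio z * common_diff z)%C = z 0%nat by rewrite /ratio; field.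
  rewrite /Rd; ring.
Qed.

Lemma filt_inv_common_diff lam c :
  (forall e e', lam (fun i => e i + e' i)%Z = (lam e + lam e')%Z) ->
  (c <= lam (delta d (-1)))%Z -> (0 <= lam (delta 0 1) + lam (delta d (-1)))%Z ->
  filt d lam T c (fun z => / common_diff z)%C.
Proof.
move=> Hadd Hc H0; have H := INR_d_ge_1.
have Hi : 0 < / INR d by apply: Rinv_0_lt_compat; lra.
apply: (filt_sub _ _ (box d eps eps)); first by move=> z Hz; apply: torus_box Hz => i Hi'; lra.
apply: filt_inv_linear => //; try lia.
rewrite Rabs_R0 Rabs_pos_eq; last lra.
have := Rmult_lt_compat_l _ _ _ Hi eps0_lt_epsd; lra.
Qed.

Lemma filt_common_diff lam c :
  (forall e e', lam (fun i => e i + e' i)%Z = (lam e + lam e')%Z) ->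
  (c <= lam (delta d 1))%Z -> (c <= lam (delta 0 1))%Z -> filt d lam T c common_diff.
Proof.
move=> Hadd Hc H0; have ann := annular_torus d eps eps_pos.
apply: filt_minus; first by apply: filt_scal => //; apply: filt_coord.
by apply: filt_plus => //; apply: filt_scal => //; apply: filt_coord => //; lia.
Qed.

Let add_0 (e e' : nat -> Z) : (e 0%nat + e' 0%nat = e 0%nat + e' 0%nat)%Z := eq_refl.
Let add_d (e e' : nat -> Z) : (e d + e' d = e d + e' d)%Z := eq_refl.

(** A Taylor term of order [m < j] leaves [v^(j - 1 - m)], a polynomial in [z_0] and [z_d], so no
    pole in [z_d] arises. *)
Lemma filt_low_order (t : nat -> R) (n : nat) : (n <= j)%nat ->
  filt d (fun e => e d) T 0
    (fun z => (/ z 0%nat) ^ S j * common_diff z ^ j / common_diff z * taylor_sum t n (ratio z))%C.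
Proof.
have ann := annular_torus d eps eps_pos.
elim: n => [|n IH] Hn.
  apply: (filt_ext _ _ _ _ (fun _ => RtoC 0)); last exact: filt_const.
  by move=> z _ /=; ring.
apply: (filt_ext _ _ _ _ (fun z =>
  (/ z 0%nat) ^ S j * common_diff z ^ j / common_diff z * taylor_sum t n (ratio z) +
  RtoC (t n) * ((/ z 0%nat) ^ S j * (z 0%nat ^ n * common_diff z ^ (j - 1 - n))))%C).
  move=> z Hz /=; have Hv := common_diff_neq_0 z Hz.
  have E : (common_diff z ^ j)%C =
      (common_diff z ^ (j - 1 - n) * common_diff z ^ n * common_diff z)%C.
    rewrite -Cpow_add_r Cmult_comm -Cpow_S; congr Cpow; lia.
  rewrite E /ratio Cpow_mult_l (Cpow_inv (common_diff z)) //.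
  have Hvn := Cpow_nz _ n Hv.
  move: (/ z 0%nat * _)%C (taylor_sum t n _) => A B.
  by field.
apply: filt_plus => //; first by apply: IH; lia.
apply: filt_scal => //.
apply: (filt_mult _ _ _ add_d ann 0 0) => //.
  by apply: filt_pow_0 => //; apply: filt_coord_inv; [lia | solve_delta].
apply: (filt_mult _ _ _ add_d ann 0 0) => //.
  by apply: filt_pow_0 => //; apply: filt_coord; [lia | solve_delta].
by apply: filt_pow_0 => //; apply: filt_common_diff => //; solve_delta.
Qed.

Lemma filt_ratio : filt d (fun e => e 0%nat) T 0 ratio.
Proof.
have ann := annular_torus d eps eps_pos.
apply: (filt_mult _ _ _ add_0 ann 0 0) => //.
  by apply: filt_coord; [lia | solve_delta].
by apply: filt_inv_common_diff => //; solve_delta.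
Qed.

Lemma filt_inv_shift l : (1 <= l <= d)%nat ->
  filt d (fun e => e 0%nat) T 0 (fun z => / (RtoC (INR l) + ratio z))%C.
Proof.
move=> Hl; have ann := annular_torus d eps eps_pos.
(* [l + z_0 / v] is the [l]-th point of the progression divided by [v]. *)
apply: (filt_ext _ _ _ _ (fun z => common_diff z * / arith d z l)%C).
  move=> z Hz; have Hv := common_diff_neq_0 z Hz; have Ha := arith_neq_0 z l Hz Hl.
  have E : arith d z l = ((RtoC (INR l) + ratio z) * common_diff z)%C.
    by rewrite arith_common_diff /ratio; [field | lia].
  rewrite E in Ha *.
  field; split=> //; by move=> E'; apply: Ha; rewrite E' Cmult_0_l.
apply: (filt_mult _ _ _ add_0 ann 0 0) => //.
  by apply: filt_common_diff => //; solve_delta.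
apply: (filt_sub _ _ (box d eps eps)); first by move=> z Hz; apply: torus_box Hz => i Hi'; lra.
have He0 := eps_pos 0%nat ltac:(lia).
apply: filt_inv_arith => //; try solve_delta; lra.
Qed.

Lemma filt_inv_den : filt d (fun e => e 0%nat) T 0 (fun z => / denC N d (ratio z))%C.
Proof.
have ann := annular_torus d eps eps_pos.
apply: (filt_ext _ _ _ _ (fun z => / (RtoC (INR d) + ratio z) *
   Cprod (fun l => (/ (RtoC (INR l) + ratio z)) ^ N) 1 d)%C).
  move=> z Hz; rewrite /denC Cinv_mult; congr (_ * _)%C.
  by rewrite Cprod_inv; apply: Cprod_ext => l _; rewrite Cinv_pow.
apply: (filt_mult _ _ _ add_0 ann 0 0) => //; first by apply: filt_inv_shift; lia.
apply: (filt_Cprod_0 _ _ _ add_0 ann _ _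
  (fun l z => (/ (RtoC (INR l) + ratio z)) ^ N)%C) => l Hl.
by apply: filt_pow_0 => //; exact: filt_inv_shift.
Qed.

Lemma Rd_mon z : (Rd z * (/ z 0%nat * / z d))%C = mon d (fun _ => (-1)%Z) z.
Proof.
have -> : mon d (fun _ => (-1)%Z) z = Cprod (fun l => / z l)%C 0 d.
  by apply: Cprod_ext => k _ /=; rewrite Cmult_1_r.
rewrite Cprod_recl; last lia.
have Ed : d = S (d - 1) by lia.
rewrite [in RHS]Ed Cprod_recr; last lia.
rewrite -Ed /Rd; ring.
Qed.

Lemma torus_int_stage_d :
  torus_int eps d (stage N d j d) =
  (/ RtoC (INR N) ^ d * RtoC (taylor_coef (fun x => numR N d x / denR N d x)%R j))%C.
Proof.
have ann := annular_torus d eps eps_pos.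
set t := taylor_coef _.
have [b [B [Hb HB]]] := taylor_quotient (S j) _ _ _ _ (poly_num N d) (poly_den N d)
  (denR_0_neq_0 N d Hd).
have denC_neq_0 : forall z, T z -> denC N d (ratio z) <> 0.
  move=> z Hz; have Hv := common_diff_neq_0 z Hz.
  have H : forall l, (1 <= l <= d)%nat -> (RtoC (INR l) + ratio z)%C <> 0.
    move=> l Hl E; apply: (arith_neq_0 z l Hz Hl).
    have -> : arith d z l = ((RtoC (INR l) + ratio z) * common_diff z)%C.
      by rewrite arith_common_diff /ratio; [field | lia].
    by rewrite E Cmult_0_l.
  apply: Cmult_neq_0; first by apply: H; lia.
  by apply: Cprod_neq_0 => l Hl; apply: Cpow_nz; apply: H.
set K := (/ RtoC (INR N) ^ d * RtoC (/ INR d))%C.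
(* [F1] collects the Taylor orders below [j], [F3] those above. Order [j] gives [1 / (z_0 v) = d /
   (z_0 z_d) + 1 / (z_d v)], whose first term is the monomial to be kept and whose second is [F2].
   [F1] has no pole in [z_d]; [F2] and [F3] have none in [z_0]. *)
pose F1 z := (Rd z *
  ((/ z 0%nat) ^ S j * common_diff z ^ j / common_diff z * taylor_sum t j (ratio z)))%C.
pose F2 z := (Rd z * (/ z d * / common_diff z))%C.
pose F3 z := (Rd z * ((/ common_diff z) ^ 2 * (B (ratio z) * / denC N d (ratio z))))%C.
have H1 : filt d lam0 T 0 F1 /\ torus_int eps d F1 = 0.
  apply: (filt_torus_int_0 d eps (fun e => e d) 0) => //; first by move=> e ->; lia.
  apply: (filt_mult _ _ _ add_d ann 0 0) => //.
    by apply: filt_Cprod_coord_inv => //; [lia | move=> l Hl; solve_delta].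
  exact: filt_low_order.
have H2 : filt d lam0 T 0 F2 /\ torus_int eps d F2 = 0.
  apply: (filt_torus_int_0 d eps (fun e => e 0%nat) 0) => //; first by move=> e ->; lia.
  apply: (filt_mult _ _ _ add_0 ann 0 0) => //.
    by apply: filt_Cprod_coord_inv => //; [lia | move=> l Hl; solve_delta].
  apply: (filt_mult _ _ _ add_0 ann 0 0) => //.
    by apply: filt_coord_inv => //; solve_delta.
  by apply: filt_inv_common_diff => //; solve_delta.
have H3 : filt d lam0 T 0 F3 /\ torus_int eps d F3 = 0.
  apply: (filt_torus_int_0 d eps (fun e => e 0%nat) 0) => //; first by move=> e ->; lia.
  apply: (filt_mult _ _ _ add_0 ann 0 0) => //.
    by apply: filt_Cprod_coord_inv => //; [lia | move=> l Hl; solve_delta].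
  apply: (filt_mult _ _ _ add_0 ann 0 0) => //.
    by apply: filt_pow_0 => //; apply: filt_inv_common_diff => //; solve_delta.
  apply: (filt_mult _ _ _ add_0 ann 0 0) => //; last exact: filt_inv_den.
  by apply: filt_poly Hb filt_ratio.
have H23 := torus_int_plus_0 d eps (RtoC (t j)) F2 F3 eps_pos H2 H3.
have [H4 H4'] := torus_int_plus_0 d eps 1%C _ _ eps_pos H1 H23.
have [H5 H5'] := torus_int_plus_0 d eps (K - 1)%C _ _ eps_pos (conj H4 H4') (conj H4 H4').
set G := fun z : nat -> C => ((K - 1) * _ + _)%C in H5 H5'.
have Hmon : filt d lam0 T 0 (mon d (fun _ => (-1)%Z)) by apply: approx_mon; rewrite /lam0; lia.
transitivity (torus_int eps d (fun z =>
  K * (RtoC (INR d) * RtoC (t j)) * mon d (fun _ => (-1)%Z) z + G z)%C).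
  apply: torus_int_ext => // z Hz.
  have Hv := common_diff_neq_0 z Hz. have HD := denC_neq_0 z Hz.
  have Hz0 := annular_neq_0 d T ann z 0 Hz ltac:(lia).
  have Hzd := annular_neq_0 d T ann z d Hz ltac:(lia).
  rewrite stage_d_eq // -/K -Rd_mon HB -/t /G /F1 /F2 /F3.
  change (taylor_sum t (S j) (ratio z)) with
    (taylor_sum t j (ratio z) + RtoC (t j) * ratio z ^ j)%C.
  have E : (ratio z ^ j)%C = (z 0%nat ^ j * / common_diff z ^ j)%C.
    by rewrite /ratio Cpow_mult_l Cpow_inv.
  have Ed : z d = (z 0%nat + RtoC (INR d) * common_diff z)%C by rewrite d_common_diff; ring.
  rewrite (Cpow_inv (z 0%nat)) // !Cpow_S E.
  have Hvj := Cpow_nz _ j Hv. have Hz0j := Cpow_nz _ j Hz0.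
  move: (taylor_sum t j (ratio z)) (Rd z) (denC N d (ratio z)) HD (B (ratio z)) => y5 y6 y7 HD y8.
  rewrite Ed in Hzd *.
  have -> : ratio z = (z 0%nat * / common_diff z)%C by [].
  clear H5 H5' G; move: K => k1.
  move: (z 0%nat ^ j)%C (common_diff z ^ j)%C (common_diff z) (z 0%nat)
    Hvj Hz0j Hv Hz0 Hzd => y1 y2 y3 y4 *.
  by field.
rewrite (torus_int_lincomb d eps eps_pos _ _ _ _ _ Hmon H5) H5' torus_int_mon //.
have -> : forallb (fun k => ((-1) =? -1)%Z) (seq 0 (S d)) = true by apply/forallb_forall.
have H := INR_d_ge_1.
have HC : RtoC (INR d) <> 0 by move/RtoC_inj; lra.
rewrite /K RtoC_inv; last lra.
have HNd : (RtoC (INR N) ^ d)%C <> 0.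
  by apply: Cpow_nz; move/RtoC_inj; apply: not_0_INR; lia.
by field.
Qed.

End Evaluation.

(** * Shrinking the circle of [z_0], and conclusion *)

Lemma shrink_eps0 (d : nat) (eps : nat -> R) : (1 <= d)%nat -> admissible d eps ->
  exists e0, 0 < e0 <= eps 0%nat /\ forall i, (1 <= i <= d)%nat -> INR d * e0 < eps i.
Proof.
move=> Hd [Hpos _].
have [a [Ha H]] : exists a, 0 < a /\ forall i, (i <= d)%nat -> a <= eps i.
  elim: {Hd} d Hpos => [|n IH] Hpos.
    exists (eps 0%nat); split; first exact: Hpos.
    move=> i Hi; have -> : i = 0%nat by lia. exact: Rle_refl.
  have [a [Ha H]] := IH (fun i Hi => Hpos i ltac:(lia)).
  exists (Rmin a (eps (S n))); split; first by apply: Rmin_pos => //; apply: Hpos.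
  move=> i Hi; case: (Nat.eq_dec i (S n)) => [->|Hn]; first exact: Rmin_r.
  by apply: Rle_trans (Rmin_l _ _) (H i _); lia.
have Hd1 : 1 <= INR d by apply: (le_INR 1 d).
exists (a / (2 * INR d)); split.
  split; first by apply: Rdiv_lt_0_compat; lra.
  apply: Rle_trans (H 0%nat ltac:(lia)).
  apply: (Rmult_le_reg_r (2 * INR d)); first lra.
  rewrite /Rdiv Rmult_assoc Rinv_l; last lra. nra.
move=> i Hi; have := H i ltac:(lia).
replace (INR d * (a / (2 * INR d))) with (a / 2) by (field; lra).
lra.
Qed.

Lemma torus_int_w_integrand (N d j : nat) (eps : nat -> R) :
  (2 <= N)%nat -> (1 <= d)%nat -> (j <= N - 2)%nat -> admissible d eps ->
  torus_int eps d (w_integrand N d j (N - 2 - j) (-1)) =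
  RtoC (INR N * taylor_coef (fun x => numR N d x / denR N d x) j).
Proof.
move=> HN Hd Hj adm; have [Hpos Hconc] := adm.
have [e0 [He0 Htiny]] := shrink_eps0 d eps Hd adm.
(* Lowering only [|z_0|] keeps admissibility, and no [defect] vanishes on the box between the two
   tori. *)
pose eps' i := if (i =? 0)%nat then e0 else eps i.
have epsE : forall i, (1 <= i)%nat -> eps' i = eps i by case=> [|i] Hi; [lia | ].
have adm' : admissible d eps'.
  split=> i Hi.
    by case: i Hi => [|i] Hi; [rewrite /eps' /=; lra | apply: Hpos].
  have := Hconc i Hi; rewrite (epsE (i + 1)%nat) ?(epsE i); try lia.
  have : eps' (i - 1)%nat <= eps (i - 1)%nat.
    by rewrite /eps'; case: Nat.eqb_spec => [->|_]; lra.
  lra.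
have Htiny' : forall i, (1 <= i <= d)%nat -> INR d * eps' 0%nat < eps' i.
  by move=> i Hi; rewrite (epsE i); [apply: Htiny | lia].
have Hpos' := proj1 adm'.
have Hle : forall i, eps' i <= eps i by case=> [|i]; rewrite /eps' /=; lra.
have ann : annular d (box d eps' eps) := annular_box d eps' eps Hpos'.
have HX : forall z, torus d eps z -> box d eps' eps z.
  by move=> z; apply: torus_box => i Hi; have := Hle i; lra.
have HX' : forall z, torus d eps' z -> box d eps' eps z.
  by move=> z; apply: torus_box => i Hi; have := Hle i; lra.
have Hfilt : filt d lam0 (box d eps' eps) 0 (stage N d j 1).
  apply: (filt_ext _ _ _ _ (fun z =>
    numer N d j z * (RtoC 1) * Cprod (fun l => / defect l z) 1 (d - 1))%C).
    by move=> z _; rewrite /stage arith_1 (Cprod_nil _ 1 (1 - 1)) ?Rinv_1 ?Cmult_1_l //; lia.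
  have coord : forall i, (i <= d)%nat ->
     filt d lam0 (box d eps' eps) 0 (fun z => z i) /\
     filt d lam0 (box d eps' eps) 0 (fun z => / z i)%C.
    by move=> i Hi; split; [apply: filt_coord | apply: filt_coord_inv].
  apply: (filt_mult _ _ _ _ ann 0 0) => //.
    apply: (filt_mult _ _ _ _ ann 0 0) => //; last exact: filt_const.
    (* With [k = d] every coordinate counts as low, and [a = 0] asks only for approximability. *)
    apply: (filt_numer N d j d 0 lam0 _ (fun z => z)) => //; first by move=> i; lia.
    by have [] := coord d (le_n d).
  apply: (filt_Cprod_0 _ _ _ _ ann _ _ (fun l z => / defect l z)%C) => // l Hl.
  apply: filt_inv_linear => //; try lia; first lra.
  rewrite Rabs_R1 (epsE l); last lia.
  have := Hconc l Hl; lra.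
transitivity (torus_int eps d (fun z =>
  (RtoC (INR N) ^ S d - 1) * stage N d j 1 z + stage N d j 1 z)%C).
  apply: torus_int_ext => // z Hz; rewrite w_integrand_stage //; first ring.
  by move=> i Hi; apply: (annular_neq_0 d _ ann z i (HX z Hz)).
have Hfilt0 := filt_sub _ _ _ _ _ _ HX Hfilt.
rewrite (torus_int_lincomb d eps Hpos _ _ _ _ _ Hfilt0 Hfilt0).
rewrite (torus_int_indep d eps eps' _ _ _ Hpos Hpos' HX HX' Hfilt).
rewrite (torus_int_stage N d j eps' adm' Htiny' d) //.
rewrite torus_int_stage_d //; try lia; last by apply: Htiny'; lia.
rewrite RtoC_mult Cpow_S.
have HNd : (RtoC (INR N) ^ d)%C <> 0.
  by apply: Cpow_nz; move/RtoC_inj; apply: not_0_INR; lia.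
by field.
Qed.

Theorem theorem1 : forall (N d j : nat) (eps : nat -> R),
  (2 <= N)%nat -> (1 <= d)%nat -> (j <= N - 2)%nat ->
  admissible d eps ->
  w_num_h_over_N N d eps j =
  RtoC (/ INR (fact j) *
        Derive_n (fun x : R =>
          Rprod (fun r => INR r + INR N * x) 1 (N * d) /
          Rprod (fun r => (INR r + x) ^ N) 1 d) j 0).
Proof.
move=> N d j eps HN Hd Hj adm.
set phi := fun x => numR N d x / denR N d x.
have Hphi : rational_near_0 phi.
  exists (numR N d), (numC N d), (denR N d), (denC N d).
  do 3 (split; first by [exact: poly_num | exact: poly_den | exact: denR_0_neq_0]).
  exact: near_forall.
have HNR : INR N <> 0 by apply: not_0_INR; lia.
(* The factor [d + x] is cancelled where the denominator is nonzero, which covers a neighbourhood of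
   0. *)
rewrite (Derive_n_ext_loc _ (fun x => (INR d + x) * phi x)); last first.
  apply: (near_imp _ _ _ (poly_neq_0 _ _ (poly_den N d) (denR_0_neq_0 N d Hd))) => x.
  rewrite /phi /numR /denR.
  move: (Rprod _ 1 d) (Rprod _ 1 (N * d)) => A B H.
  have HA : A <> 0 by move=> E; apply: H; rewrite E Rmult_0_r.
  have Hx : INR d + x <> 0 by move=> E; apply: H; rewrite E Rmult_0_l.
  by field.
rewrite -[(_ * Derive_n _ j 0)%R]/(taylor_coef (fun x => (INR d + x) * phi x) j).
rewrite taylor_coef_affine_mult //.
have W : forall i, (i <= N - 2)%nat -> w_num N d eps (Z.of_nat i) (N - 2 - i) (-1) =
    RtoC (INR N * taylor_coef phi i).
  move=> i Hi; rewrite -(torus_int_w_integrand N d i eps) //.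
  by rewrite /w_num; case: i {Hi} => [|i] //; rewrite Nat2Z.id.
rewrite /w_num_h_over_N W //.
(* For [j = 0] the second integral is 0 by convention; for [j = i + 1] its exponent [N - 1 - j]
   equals [N - 2 - i], so the same evaluation applies at [i]. *)
case: j Hj => [|i] Hj.
  rewrite /= Cmult_0_r Cplus_0_r -RtoC_mult; congr RtoC; field; lra.
have -> : (Z.of_nat (S i) - 1)%Z = Z.of_nat i by lia.
have -> : (N - 1 - S i = N - 2 - i)%nat by lia.
rewrite W; last lia.
rewrite -!RtoC_mult -RtoC_plus; congr RtoC; field; lra.
Qed.
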